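(* Let $\theta,\sigma,\rho>0$ satisfy $$\theta^2>A_{12}^2,\qquad (\theta^2-A_{12}^2)(\sigma^2-A_{23}^2)>(A_{13}-A_{12}A_{23})^2,\qquad \Lambda V>\Gamma^2,$$ where $$\Lambda=(\theta^2-A_{12}^2)(\sigma^2-A_{23}^2)-(A_{13}-A_{12}A_{23})^2,$$ $$V=(\theta^2-A_{12}^2)(\sigma^2\rho^2-A_{24}^2)-(A_{14}-A_{12}A_{24})^2,$$ $$\Gamma=(\theta^2-A_{12}^2)(A_{34}\sigma^2-A_{23}A_{24})-(A_{13}-A_{12}A_{23})(A_{14}-A_{12}A_{24}).$$ Let $n$ be a positive integer and let $\{\theta_r\}_{r\ge 0}$, $\{\sigma_q\}_{q\ge 0}$, $\{\rho_p\}_{p\ge 0}$ be positive sequences satisfying $$\frac{\theta_r\theta_{r+2}}{\theta_{r+1}^2}=\theta^2,\qquad \frac{\sigma_q\sigma_{q+2}}{\sigma_{q+1}^2}=\sigma^2,\qquad \frac{\rho_p\rho_{p+2}}{\rho_{p+1}^2}=\rho^2,\qquad 0\le r\le q\le p\le n.$$ Let $(u(t,\cdot),v(t,\cdot),w(t,\cdot),z(t,\cdot))$ be a solution of the Brusselator system given in the context, with maximal existence time $T_{\max}$, and let $$L_n(t)=\int_\Omega H_n\big(u(t,x),v(t,x),w(t,x),z(t,x)\big)\,dx,$$ $$H_n(u,v,w,z)=\sum_{p=0}^{n}\sum_{q=0}^{p}\sum_{r=0}^{q}C_n^pC_p^qC_q^r\,\theta_r\sigma_q\rho_p\,u^r v^{q-r}w^{p-q}z^{n-p}.$$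 Then the functional $L_n$ is uniformly bounded on the interval $[0,T_{\max})$.
   Context: $\Omega\subset\mathbb{R}^N$ is an open bounded domain of class $C^1$ with boundary $\partial\Omega$. The constants $a,b,c,d,\alpha,\beta,D_1,D_2,D_3,D_4$ are positive. The Brusselator system is, in $\mathbb{R}^+\times\Omega$, $$\partial_t u-a\Delta u=\alpha-(\beta+1)u+u^2v+D_1(w-u),$$ $$\partial_t v-b\Delta v=\beta u-u^2v+D_2(z-v),$$ $$\partial_t w-c\Delta w=\alpha-(\beta+1)w+w^2z+D_3(u-w),$$ $$\partial_t z-d\Delta z=\beta w-w^2z+D_4(v-z),$$ with homogeneous Dirichlet boundary condition $u=v=w=z=0$ on $\mathbb{R}^+\times\partial\Omega$ and initial data $u_0,v_0,w_0,z_0$, which are nonnegative bounded functions on $\Omega$. A solution means the unique classical (componentwise nonnegative) solution on $(0,T_{\max})\times\Omega$, where $T_{\max}\in(0,\infty]$ is the maximal existence time: if $T_{\max}<\infty$ then $\|u(t,\cdot)\|_\infty+\|v(t,\cdot)\|_\infty+\|w(t,\cdot)\|_\infty+\|z(t,\cdot)\|_\infty\to\infty$ as $t\nearrow T_{\max}$. Notation: $A_{12}=\frac{a+b}{2\sqrt{ab}}$, $A_{13}=\frac{a+c}{2\sqrt{ac}}$, $A_{14}=\frac{a+d}{2\sqrt{ad}}$, $A_{23}=\frac{b+c}{2\sqrt{bc}}$, $A_{24}=\frac{b+d}{2\sqrt{bd}}$, $A_{34}=\frac{c+d}{2\sqrt{cd}}$. $C_n^p=\binom{n}{p}$ denotes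 the binomial coefficient. *)

(* Defs.v *)
From HB Require Import structures.
From mathcomp Require Import all_boot all_order all_algebra.
From mathcomp Require Import all_classical all_reals all_analysis.
Set Implicit Arguments.
Unset Strict Implicit.
Unset Printing Implicit Defensive.
Import Order.TTheory GRing.Theory Num.Theory.
Import numFieldNormedType.Exports.
Local Open Scope classical_set_scope.
Local Open Scope ring_scope.

Section cons_measure.
Context d (T : measurableType d) (R : realType) (n : nat).
Variables (m1 : {sigma_finite_measure set T -> \bar R})
          (m : {sigma_finite_measure set (n.-tuple T) -> \bar R}).

Definition cons_pair (p : T * n.-tuple T) : n.+1.-tuple T :=
  [tuple of p.1 :: p.2].

Definition cons_measure : set (n.+1.-tuple T) -> \bar R :=
  pushforward (product_measure1 m1 m) cons_pair.

Let measurable_cons_pair : measurable_fun [set: T * n.-tuple T] cons_pair.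
Proof. exact: (measurable_cons measurable_fst measurable_snd). Qed.

Let mpush A : measurable A -> measurable (cons_pair @^-1` A).
Proof. by move=> mA; rewrite -[X in measurable X]setTI; exact: measurable_cons_pair. Qed.

Let cons_measure0 : cons_measure set0 = 0%E.
Proof. by rewrite /cons_measure /pushforward preimage_set0 measure0. Qed.

Let cons_measure_ge0 A : (0 <= cons_measure A)%E.
Proof. exact: measure_ge0. Qed.

Let cons_measure_sigma_additive : semi_sigma_additive cons_measure.
Proof.
move=> F mF tF mUF; rewrite /cons_measure /pushforward preimage_bigcup.
apply: measure_semi_sigma_additive.
- by move=> k; exact: mpush.
- apply/trivIsetP => /= i j _ _ ij; rewrite -preimage_setI.
  by move/trivIsetP : tF => /(_ _ _ _ _ ij) ->//; rewrite preimage_set0.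
- by rewrite -preimage_bigcup; exact: mpush.
Qed.

HB.instance Definition _ := isMeasure.Build _ _ _ cons_measure
  cons_measure0 cons_measure_ge0 cons_measure_sigma_additive.

Let cons_measure_sigma_finite : sigma_finite setT cons_measure.
Proof.
have /sigma_finiteP[F [TF ndF Foo]] := sigma_finiteT m1.
have /sigma_finiteP[G [TG ndG Goo]] := sigma_finiteT m.
pose g (t : n.+1.-tuple T) : T * n.-tuple T := (thead t, [tuple of behead t]).
have mg : measurable_fun [set: n.+1.-tuple T] g.
  apply: measurable_fun_pair; last exact: measurable_behead.
  exact: measurable_tnth.
have gK : g \o cons_pair = id.
  apply/funext => -[x t] /=; rewrite /g /cons_pair /= theadE; congr pair.
  exact/val_inj.
exists (fun k => g @^-1` (F k `*` G k)).
  rewrite -preimage_bigcup -[LHS](preimage_setT g); congr (g @^-1` _).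
  rewrite -setXTT TF TG predeqE => -[x y]; split.
    move=> [/= [k _ Fkx] [l _ Gly]]; exists (maxn k l) => //; split.
    - by move: x Fkx; exact/subsetPset/ndF/leq_maxl.
    - by move: y Gly; exact/subsetPset/ndG/leq_maxr.
  by move=> [k _ []/= ? ?]; split; exists k.
move=> k; have [? ?] := Foo k; have [? ?] := Goo k; split.
  by rewrite -[X in measurable X]setTI; apply: mg => //; exact: measurableX.
rewrite /cons_measure /pushforward -comp_preimage gK preimage_id.
by rewrite product_measure1E// lte_mul_pinfty// ge0_fin_numE.
Qed.

HB.instance Definition _ := Measure_isSigmaFinite.Build _ _ _ cons_measure
  cons_measure_sigma_finite.

End cons_measure.

(* Lebesgue measure on (the Borel sets of) R^n, as the n-fold product of the
   one-dimensional Lebesgue measure. *)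
Fixpoint lebesgue_tuple (R : realType) (n : nat) :
    {sigma_finite_measure set (n.-tuple (measurableTypeR R)) -> \bar R} :=
  if n is n'.+1 then cons_measure lebesgue_measure (lebesgue_tuple R n')
  else \d_([tuple] : 0.-tuple (measurableTypeR R)).

Section euclidean_space.
Context {R : realType} {N : nat}.
Implicit Types (Om : set 'rV[R]_N) (f : 'rV[R]_N -> R).

(* The topology of R^N is that of 'rV[R]_N; its Borel structure is that of
   N.-tuple R. The two carriers are identified by this bijection. *)
Definition rV_of_tuple (y : N.-tuple (measurableTypeR R)) : 'rV[R]_N :=
  \row_i tnth y i.

Definition integral_rV Om (f : 'rV[R]_N -> \bar R) : \bar R :=
  (\int[lebesgue_tuple R N]_(y in rV_of_tuple @^-1` Om) f (rV_of_tuple y))%E.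

(* Lebesgue measurability on Om: equality a.e. with a Borel function. *)
Definition measurable_rV Om f : Prop :=
  exists2 g : N.-tuple (measurableTypeR R) -> R, measurable_fun setT g &
    {ae lebesgue_tuple R N, forall y,
      Om (rV_of_tuple y) -> f (rV_of_tuple y) = g y}.

Definition partial (i : 'I_N) f : 'rV[R]_N -> R := 'D_(delta_mx 0 i) f.

Definition laplacian f (x : 'rV[R]_N) : R := \sum_(i < N) partial i (partial i f) x.

Definition C1 f : Prop :=
  continuous f /\
  forall i : 'I_N, (forall x, derivable f x (delta_mx 0 i)) /\
    continuous (partial i f).

Definition domain Om : Prop := [/\ open Om, connected Om & Om !=set0].

Definition sup_norm Om f : \bar R := ereal_sup [set `|f x|%:E | x in Om].

End euclidean_space.

(* Near each boundary point Om is, after relabelling (i) and possibly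
   reorienting (s) the coordinate axes, the region strictly above the graph of
   a C^1 function of the N.-1 remaining coordinates. *)
Definition C1_boundary (R : realType) (N : nat) (Om : set 'rV[R]_N) : Prop :=
  forall x0 : 'rV[R]_N, (closure Om `\` interior Om) x0 ->
    exists r : R, exists i : 'I_N, exists s : bool,
    exists g : 'rV[R]_N.-1 -> R,
    [/\ 0 < r, C1 g &
        forall x, ball x0 r x -> (Om x <-> g (col' i x) < (-1) ^+ s * x 0 i)].

Section parabolic.
Context {R : realType} {N : nat}.
Variables (Om : set 'rV[R]_N) (T : \bar R).
Implicit Types (u : R -> 'rV[R]_N -> R).

Definition time_derivative u (t : R) (x : 'rV[R]_N) : R := derive1 (u ^~ x) t.

(* u is C^1 in time and C^2 in space on (0, T) x Om. *)
Definition C12 u : Prop :=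
  forall (t : R) (x : 'rV[R]_N), 0 < t -> (t%:E < T)%E -> Om x ->
  [/\ derivable (u ^~ x) t 1,
      {for (t, x), continuous (fun p : R * 'rV[R]_N => time_derivative u p.1 p.2)},
      forall i : 'I_N, derivable (u t) x (delta_mx 0 i) /\
        {for (t, x), continuous (fun p : R * 'rV[R]_N => partial i (u p.1) p.2)} &
      forall i j : 'I_N, derivable (partial i (u t)) x (delta_mx 0 j) /\
        {for (t, x), continuous
           (fun p : R * 'rV[R]_N => partial j (partial i (u p.1)) p.2)}].

(* Regularity, sign, homogeneous Dirichlet condition and initial condition of
   one component of a classical solution. As u0 is only bounded, it is attained
   in every L^p(Om), 1 <= p < oo, with u bounded on [0, T'] x Om for T' < T. *)
Record classical_component (u0 : 'rV[R]_N -> R) u : Prop := {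
  component_C12 : C12 u ;
  component_continuous : {within
    [set p : R * 'rV[R]_N | [/\ 0 < p.1, (p.1%:E < T)%E & closure Om p.2]],
    continuous (fun p : R * 'rV[R]_N => u p.1 p.2)} ;
  component_ge0 : forall t x, 0 <= t -> (t%:E < T)%E -> Om x -> 0 <= u t x ;
  component_dirichlet : forall t x, 0 < t -> (t%:E < T)%E ->
    (closure Om `\` interior Om) x -> u t x = 0 ;
  component_bounded : forall T' : R, (T'%:E < T)%E ->
    exists M : R, forall t x, 0 <= t <= T' -> Om x -> `|u t x| <= M ;
  component_initial : forall x, Om x -> u 0 x = u0 x ;
  component_initial_cvg : forall p : R, 1 <= p ->
    (fun t => integral_rV Om (fun x => (`|u t x - u0 x| `^ p)%:E)) @ 0^'+
      --> 0%E }.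

(* blow_up is what makes T the maximal existence time. *)
Record brusselator_solution (a b c d alpha beta D1 D2 D3 D4 : R)
    (u0 v0 w0 z0 : 'rV[R]_N -> R) (u v w z : R -> 'rV[R]_N -> R) : Prop := {
  solution_u : classical_component u0 u ;
  solution_v : classical_component v0 v ;
  solution_w : classical_component w0 w ;
  solution_z : classical_component z0 z ;
  equation_u : forall t x, 0 < t -> (t%:E < T)%E -> Om x ->
    time_derivative u t x - a * laplacian (u t) x =
      alpha - (beta + 1) * u t x + u t x ^+ 2 * v t x + D1 * (w t x - u t x) ;
  equation_v : forall t x, 0 < t -> (t%:E < T)%E -> Om x ->
    time_derivative v t x - b * laplacian (v t) x =
      beta * u t x - u t x ^+ 2 * v t x + D2 * (z t x - v t x) ;
  equation_w : forall t x, 0 < t -> (t%:E < T)%E -> Om x ->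
    time_derivative w t x - c * laplacian (w t) x =
      alpha - (beta + 1) * w t x + w t x ^+ 2 * z t x + D3 * (u t x - w t x) ;
  equation_z : forall t x, 0 < t -> (t%:E < T)%E -> Om x ->
    time_derivative z t x - d * laplacian (z t) x =
      beta * w t x - w t x ^+ 2 * z t x + D4 * (v t x - z t x) ;
  blow_up : forall Tm : R, T = Tm%:E ->
    (fun t => sup_norm Om (u t) + sup_norm Om (v t)
            + sup_norm Om (w t) + sup_norm Om (z t))%E @ Tm^'- --> +oo%E }.

End parabolic.

Definition initial_datum (R : realType) (N : nat) (Om : set 'rV[R]_N)
    (f : 'rV[R]_N -> R) : Prop :=
  [/\ measurable_rV Om f, forall x, Om x -> 0 <= f x & [bounded f x | x in Om]].

Definition diffusion_ratio (R : realType) (x y : R) : R :=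
  (x + y) / (2 * Num.sqrt (x * y)).

Definition H_poly (R : realType) (theta_ sigma_ rho_ : nat -> R) (n : nat)
    (u v w z : R) : R :=
  \sum_(p < n.+1) \sum_(q < p.+1) \sum_(r < q.+1)
    'C(n, p)%:R * 'C(p, q)%:R * 'C(q, r)%:R * theta_ r * sigma_ q * rho_ p *
    u ^+ r * v ^+ (q - r) * w ^+ (p - q) * z ^+ (n - p).

Definition L_functional (R : realType) (N : nat) (Om : set 'rV[R]_N)
    (theta_ sigma_ rho_ : nat -> R) (n : nat)
    (u v w z : R -> 'rV[R]_N -> R) (t : R) : \bar R :=
  integral_rV Om (fun x =>
    (H_poly theta_ sigma_ rho_ n (u t x) (v t x) (w t x) (z t x))%:E).

(* Main.v *)
Require Import Defs.
From HB Require Import structures.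
From mathcomp Require Import all_boot all_order all_algebra.
From mathcomp Require Import all_classical all_reals all_analysis.
From mathcomp Require Import ring lra measurable_realfun.

(** A comparison with a parabola in one coordinate bounds [v] and [z] by some
    [M]: where the larger of [v - psi] and [z - psi] is maximal, the production
    term [beta u - u^2 v <= beta^2 / 4] is beaten by the Laplacian of [psi].

    Let [X y] be the power [n + 4] of the positive part of [y - 1], and consider
    the energy [E = D3 \int X u * ph1 v + D1 \int X w * ph2 z] with weights
    [ph y = 1 + A y^2 / (y + eta) + B y^2] close to 1 on [[0, M]].
    The inequality [kap ph'^2 <= ph''] makes the diffusion quadratic form
    nonnegative; [eta] is tuned so that the terms in [u^2 v] have a sign for
    large [u]; and the factors [D3], [D1] make the coupling antisymmetric up to
    the distance of the weights to 1.  Hence [E' <= C - delta E], so [E] is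
    bounded, and it dominates the functional because [v] and [z] are bounded.
    Since [u] and [w] vanish on the boundary, [X u] and [X w] have compact
    support in [Om] and integrations by parts produce no boundary term. *)

Set Implicit Arguments.
Unset Strict Implicit.
Unset Printing Implicit Defensive.
Import Order.TTheory GRing.Theory Num.Theory.
Import numFieldNormedType.Exports.
Local Open Scope classical_set_scope.
Local Open Scope ring_scope.

(** The obstacle is the autocatalytic term [u^2 v]: it is superlinear in [u], so a bound on [v]
    alone gives none on [u], and unequal diffusions prevent summing the equations. Put [P = n + 4]
    and let [Y] be the power [P - 1] of the positive part of [u - 1]. The reaction part of the
    derivative of [X u * ph v] contains [Y u (u v - be) (P ph - (u - 1) ph')], while the loss [- u]
    yields the damping [- P ph u Y]. It thus suffices to bound the product of the two brackets by
    [P / 4] for large [u]. This asks for [ph' v] close to [P v / be] near the critical [v = be / u],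
    yet for a [ph] that stays within [eps] of 1. The summand [A v^2 / (v + eta)] has both
    properties: its slope starts as [2 A v / eta = P v / be] and never exceeds [A], which is free to
    be small. Its convexity decays like [v^-3], so [B v^2] is added to keep [kap ph'^2 <= ph''] up
    to [M]. The value [kap = (a + b)^2 / (2 a b)] comes from the discriminant of the diffusion form,
    made independent of [n] by [P <= 2 (P - 1)]. A small [eps] lets the damping absorb all
    couplings. *)

(** * Borel sets and boxes in the product model of Euclidean space *)

Section euclidean_measure.
Context {R : realType}.

(** Tuples carry the sigma-algebra generated by the coordinates, row vectors the topology of the sup
    norm. The two are linked by writing [U] as the union of the countably many boxes inside it with
    rational centre and radius [1 / (k + 1)]; in [B], a box not contained in [U] is replaced by the
    empty set. *)
Lemma open_rV_measurable (N : nat) (U : set 'rV[R]_N) :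
  open U -> measurable (rV_of_tuple @^-1` U).
Proof.
move=> oU; pose B (i : 'rV[rat]_N * nat) : set (N.-tuple (measurableTypeR R)) :=
  if `[< forall x : 'rV[R]_N, (forall j, `|x 0 j - ratr (i.1 0 j)| < i.2.+1%:R^-1) -> U x >]
  then \bigcap_(j in [set: 'I_N]) [set y | `|tnth y j - ratr (i.1 0 j)| < i.2.+1%:R^-1]
  else set0.
have -> : rV_of_tuple @^-1` U = \bigcup_i B i.
  rewrite predeqE => y; split => [Uy|[i _]]; last first.
    rewrite /B; case: asboolP => // iU yB; apply: iU => j.
    by rewrite mxE; exact: yB.
  have /nbhs_ballP[e /= e0 eU] : nbhs (rV_of_tuple y) U by exact: open_nbhs_nbhs.
  have [k ke] : exists k : nat, k.+1%:R^-1 < e / 2.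
    exists (Num.truncn (e / 2)^-1); rewrite invf_plt ?posrE// ?divr_gt0//.
    by rewrite truncnS_gt.
  have d0 : 0 < k.+1%:R^-1 :> R by rewrite invr_gt0.
  have /choice[q Hq] : forall j : 'I_N, exists q : rat,
      `|tnth y j - ratr q| < k.+1%:R^-1.
    move=> j; have /rat_in_itvoo[q] : tnth y j - k.+1%:R^-1 < tnth y j + k.+1%:R^-1.
      by rewrite ltrD2l gtrN.
    by rewrite in_itv/= => qy; exists q; rewrite -ltr_distlC in qy.
  exists (\row_j q j, k) => //; rewrite /B/=; case: asboolP => [_|].
    by move=> j _ /=; rewrite mxE; exact: Hq.
  case=> x xq; apply: eU; split => // i j; rewrite ord1.
  rewrite /ball/= mxE (splitr e); apply: (@le_lt_trans _ _
    (`|tnth y j - ratr (q j)| + `|ratr (q j) - x 0 j|)).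
    by rewrite -[X in `|X| <= _](_ : (tnth y j - ratr (q j)) + (ratr (q j) - x 0 j) = _) ?ler_normD// addrA subrK.
  rewrite ltrD//; first exact: lt_trans (Hq j) ke.
  by rewrite distrC; have := xq j; rewrite mxE => /lt_trans; exact.
apply: (@countable_bigcupT_measurable _ _ ('rV[rat]_N * nat)%type B).
  exact: countableP.
move=> [q k].
rewrite /B; case: asboolP => // _.
apply: (@fin_bigcap_measurable _ (N.-tuple (measurableTypeR R))) => [|j _]; first exact: finite_finset.
rewrite (_ : mkset _ = [set: N.-tuple (measurableTypeR R)] `&`
    (fun y => tnth y j) @^-1` ball (ratr (q 0 j) : R) k.+1%:R^-1).
  apply: measurable_tnth => //; apply: open_measurable; exact: ball_open.
by rewrite setTI; apply/seteqP; split => x /=; rewrite /ball/= distrC.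
Qed.

Lemma continuous_rV_measurable (N : nat) (f : 'rV[R]_N -> R) :
  continuous f -> measurable_fun setT (f \o rV_of_tuple).
Proof.
move=> /continuousP cf; apply: (measurability _ (RGenOpens.measurableE R)).
move=> _ [_ [a [b ->] <-]]; rewrite setTI.
rewrite comp_preimage; apply: open_rV_measurable; apply: cf; exact: interval_open.
Qed.

Definition tuple_box (n : nat) (r : R) : set (n.-tuple (measurableTypeR R)) :=
  [set y | forall i, `|tnth y i| <= r].

Lemma tuple_box_measurable n r : measurable (@tuple_box n r).
Proof.
rewrite (_ : tuple_box r = \bigcap_(j in [set: 'I_n]) [set y | `|tnth y j| <= r]).
  apply: (@fin_bigcap_measurable _ (n.-tuple (measurableTypeR R))) => [|j _]; first exact: finite_finset.
  rewrite -[X in measurable X]setTI.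
  rewrite (_ : mkset _ = (fun y : n.-tuple (measurableTypeR R) => tnth y j) @^-1` `[-r, r]).
    exact: measurable_tnth.
  by apply/seteqP; split => y /=; rewrite in_itv/= ler_norml.
by apply/seteqP; split => y H j //=; apply: H.
Qed.

Lemma cons_pair_box n r : @cons_pair _ (measurableTypeR R) n @^-1` tuple_box r =
  `[- r, r] `*` tuple_box r.
Proof.
apply/seteqP; split => -[x t] /=.
  move=> H; split; first by have := H ord0; rewrite in_itv/= -ler_norml.
  by move=> i; have := H (lift ord0 i); rewrite tnthS.
rewrite in_itv/= -ler_norml => -[Hx Ht] i; case: (unliftP ord0 i) => [j|] ->.
  by rewrite tnthS.
by [].
Qed.

Lemma lebesgue_tuple_box_lty n r : (lebesgue_tuple R n (tuple_box r) < +oo)%E.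
Proof.
elim: n => [|n IH]; first by rewrite /= /dirac indicE ltry.
rewrite /= /cons_measure /pushforward cons_pair_box.
rewrite product_measure1E//; last exact: tuple_box_measurable.
have itv_lty : (lebesgue_measure ([set` `[(- r)%R, r]%R] : set (measurableTypeR R)) < +oo)%E.
  by rewrite lebesgue_measure_itv/=; case: ifP => // _; rewrite -EFinB ltry.
by rewrite lte_mul_pinfty// ge0_fin_numE.
Qed.

End euclidean_measure.

(** * Integrals of derivatives of compactly supported functions *)

Section divergence.
Context {R : realType}.

Lemma bounded_support_integrable d (T : measurableType d)
    (mu : {measure set T -> \bar R}) (A : set T) (G : T -> R) (M : R) :
  measurable A -> (mu A < +oo)%E -> measurable_fun setT G ->
  (forall x, `|G x| <= M) -> (forall x, ~ A x -> G x = 0) ->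
  mu.-integrable setT (EFin \o G).
Proof.
move=> mA Aoo mG GM GA.
rewrite (_ : EFin \o G = (EFin \o G) \_ A).
  apply: (integrable_mkcond _ mA).1; apply: measurable_bounded_integrable => //.
    exact: measurable_funTS.
  by exists M; split; [exact: num_real|move=> y /ltW My x _; exact: le_trans My].
apply/funext => x; rewrite patchE; case: ifPn => // /negP xA /=.
by rewrite GA// => Ax; apply: xA; rewrite inE.
Qed.

Lemma integral_derive_compact (f G : R -> R) (r : R) :
  (forall h : R, is_derive h 1 f (G h)) -> continuous G ->
  (forall h, r < `|h| -> f h = 0 /\ G h = 0) ->
  (\int[lebesgue_measure]_h (G h)%:E = 0)%E.
Proof.
move=> dfG cG fG0; pose s := `|r| + 1.
have s0 : 0 < s by rewrite ltr_wpDl.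
have rs : r < s by rewrite (le_lt_trans (ler_norm _))// ltrDl.
have -> : (\int[lebesgue_measure]_h (G h)%:E =
    \int[lebesgue_measure]_(h in `[(- s)%R, s%R]) (G h)%:E)%E.
  rewrite [RHS]integral_mkcond; apply: eq_integral => h _; rewrite patchE.
  case: ifPn => // /negP hs; congr EFin; apply: (fG0 _ _).2.
  rewrite (lt_le_trans rs)// leNgt; apply/negP => hs'; apply: hs.
  by rewrite inE/= in_itv/= -ler_norml ltW.
have cf : continuous f.
  by move=> x; apply: differentiable_continuous; apply/derivable1_diffP; apply: ex_derive.
rewrite (@continuous_FTC2 _ G f).
- have [-> _] := fG0 s (lt_le_trans rs (ler_norm _)).
  have [|-> _] := fG0 (- s); first by rewrite normrN (lt_le_trans rs (ler_norm _)).
  by rewrite subee.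
- by rewrite gtrN.
- exact: continuous_subspaceT.
- split; first by move=> x _; apply: ex_derive.
  + by apply: cvg_at_right_filter; exact: cf.
  + by apply: cvg_at_left_filter; exact: cf.
- by move=> x _; rewrite derive1E; apply: derive_val.
Qed.

Definition tuple_upd n (t : n.-tuple R) (i : 'I_n) (h : R) : n.-tuple R :=
  [tuple if j == i then h else tnth t j | j < n].

Lemma tuple_upd_cons0 n x (t : n.-tuple R) h :
  tuple_upd [tuple of x :: t] ord0 h = [tuple of h :: t].
Proof.
apply: eq_from_tnth => j; rewrite tnth_mktuple.
by case: (unliftP ord0 j) => [k|] ->; rewrite ?eqxx// tnthS tnthS.
Qed.

Lemma tuple_upd_consS n x (t : n.-tuple R) i h :
  tuple_upd [tuple of x :: t] (lift ord0 i) h = [tuple of x :: tuple_upd t i h].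
Proof.
apply: eq_from_tnth => j; rewrite tnth_mktuple.
case: (unliftP ord0 j) => [k|] ->; last by [].
by rewrite (inj_eq lift_inj) !tnthS tnth_mktuple.
Qed.

(** Fubini along the recursive construction of the measure. If [i] is not the first coordinate, the
    first one is frozen and the induction hypothesis treats the rest; if it is, it is integrated
    innermost and the one-dimensional fundamental theorem applies. *)
Lemma integral_tuple_partial n (i : 'I_n) (f G : n.-tuple (measurableTypeR R) -> R) (r M : R) :
  measurable_fun setT G -> (forall t, `|G t| <= M) ->
  (forall t, ~ tuple_box r t -> f t = 0 /\ G t = 0) ->
  (forall t (h : R), is_derive h 1 (fun h => f (tuple_upd t i h)) (G (tuple_upd t i h))) ->
  (forall t, continuous (fun h => G (tuple_upd t i h))) ->
  (\int[lebesgue_tuple R n]_t (G t)%:E = 0)%E.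
Proof.
elim: n => [|n IH] in i f G *; first by case: i.
move=> mG GM fG0 dfG cG.
have mcons : measurable_fun setT (@cons_pair _ (measurableTypeR R) n).
  exact: (measurable_cons measurable_fst measurable_snd).
have mbox := @tuple_box_measurable R n.+1 r.
have mGc : measurable_fun setT (G \o @cons_pair _ (measurableTypeR R) n).
  exact: measurableT_comp.
have iG : (product_measure1 (lebesgue_measure : set (measurableTypeR R) -> _) (lebesgue_tuple R n)).-integrable
    setT (EFin \o (G \o @cons_pair _ (measurableTypeR R) n)).
  apply: (@bounded_support_integrable _ _ _ (@cons_pair _ (measurableTypeR R) n @^-1` tuple_box r) _ M) => //.
  - by rewrite -[X in measurable X]setTI; exact: mcons.
  - exact: (lebesgue_tuple_box_lty n.+1 r).
  - by move=> x; exact: GM.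
  - by move=> x xr; exact: (fG0 _ xr).2.
rewrite /= /cons_measure integral_pushforward//; last exact/measurable_EFinP.
case: (unliftP ord0 i) => [j|] ij; subst i.
- rewrite preimage_setT -integral12_prod_meas1//; apply: integral0_eq => x _.
  rewrite /fubini_F /=; apply: (IH j (fun t => f [tuple of x :: t]) (fun t => G [tuple of x :: t])).
  + by apply: (measurableT_comp mG); exact: measurable_cons.
  + by move=> t; exact: GM.
  + move=> t tr; apply: fG0 => xtr; apply: tr => k.
    by have := xtr (lift ord0 k); rewrite tnthS.
  + move=> t h; have := dfG [tuple of x :: t] h; rewrite tuple_upd_consS.
    by under eq_fun do rewrite tuple_upd_consS.
  + move=> t; have := cG [tuple of x :: t].
    by under eq_fun do rewrite tuple_upd_consS.
- rewrite preimage_setT -integral21_prod_meas1//; apply: integral0_eq => t _.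
  rewrite /fubini_G /=.
  apply: (@integral_derive_compact (fun x => f [tuple of x :: t]) (fun x => G [tuple of x :: t]) r).
  + move=> h; have := dfG [tuple of 0 :: t] h; rewrite tuple_upd_cons0.
    by under eq_fun do rewrite tuple_upd_cons0.
  + have := cG [tuple of 0 :: t].
    by under eq_fun do rewrite tuple_upd_cons0.
  + move=> h rh; apply: fG0 => /(_ ord0); rewrite leNgt => /negP; apply.
    by [].
Qed.

End divergence.

(** * Real-valued integration of compactly supported continuous functions on the whole space *)

Section integral_over_space.
Context {R : realType}.

Lemma is_derive_line (V W : normedModType R) (f : V -> W) (x v : V) (h : R) :
  derivable f (x + h *: v) v ->
  is_derive h 1 (fun s : R => f (x + s *: v)) ('D_v f (x + h *: v)).
Proof.
have E : (fun k : R => k^-1 *: ((fun s : R => f (x + s *: v)) (k *: 1 + h)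
    - f (x + h *: v))) =
  (fun k => k^-1 *: (f (k *: v + (x + h *: v)) - f (x + h *: v))).
  apply/funext => k; congr (_ *: (f _ - _)).
  by rewrite [k *: 1]mulr1 scalerDl addrCA addrA.
by move=> df; apply: DeriveDef; rewrite /derivable /derive E.
Qed.

Variable N : nat.
Implicit Types f g : 'rV[R]_N -> R.

Lemma coord_le_norm (x : 'rV[R]_N) i : `|x 0 i| <= `|x|.
Proof.
rewrite [leRHS]mx_normrE; exact: (le_bigmax _ (fun k : 'I_1 * 'I_N => `|x k.1 k.2|) (0, i)).
Qed.

Definition vanishes_outside (r : R) f := forall x, r < `|x| -> f x = 0.

Lemma compact_support_bounded r f :
  continuous f -> vanishes_outside r f -> exists M, forall x, `|f x| <= M.
Proof.
move=> cf fr; have cK : compact [set x : 'rV[R]_N | `|x| <= r].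
  apply: bounded_closed_compact.
    by exists r; split; [exact: num_real|move=> s rs x /= /le_trans; apply; exact: ltW].
  rewrite (_ : mkset _ = Num.norm @^-1` [set y : R | y <= r])//.
  by apply: closed_comp; [move=> x _; exact: norm_continuous|exact: closed_le].
have /compact_bounded[M [_ HM]] := continuous_compact (continuous_subspaceT cf) cK.
exists (`|M| + 1) => x; have [xr|xr] := leP `|x| r; last by rewrite fr// normr0 addr_ge0.
apply: (HM (`|M| + 1)); first by rewrite (le_lt_trans (ler_norm _))// ltrDl.
by exists x.
Qed.

Lemma notin_tuple_box r (y : N.-tuple (measurableTypeR R)) :
  ~ tuple_box r y -> r < `|rV_of_tuple y|.
Proof.
move=> yr; rewrite ltNge; apply/negP => ry; apply: yr => i.
by apply: le_trans ry; have := coord_le_norm (rV_of_tuple y) i; rewrite mxE.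
Qed.

Lemma compact_support_integrable r f : continuous f -> vanishes_outside r f ->
  (lebesgue_tuple R N).-integrable setT (EFin \o (f \o rV_of_tuple)).
Proof.
move=> cf fr; have [M fM] := compact_support_bounded cf fr.
apply: (@bounded_support_integrable _ _ _ _ (tuple_box r) _ M).
- exact: tuple_box_measurable.
- exact: lebesgue_tuple_box_lty.
- exact: continuous_rV_measurable.
- by move=> y; exact: fM.
- by move=> y /notin_tuple_box; exact: fr.
Qed.

Definition integ f : R := \int[lebesgue_tuple R N]_y f (rV_of_tuple y).

Lemma integD r f g : continuous f -> vanishes_outside r f ->
  continuous g -> vanishes_outside r g ->
  integ (fun x => f x + g x) = integ f + integ g.
Proof.
move=> cf fr cg gr.
by apply: RintegralD; [|exact: (compact_support_integrable cf fr)|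
  exact: (compact_support_integrable cg gr)].
Qed.

Lemma integZ r k f : continuous f -> vanishes_outside r f ->
  integ (fun x => k * f x) = k * integ f.
Proof.
move=> cf fr; apply: (@RintegralZl _ _ _ _ _ (f \o rV_of_tuple)) => //.
exact: (compact_support_integrable cf fr).
Qed.

Lemma le_integ r f g : continuous f -> vanishes_outside r f ->
  continuous g -> vanishes_outside r g ->
  (forall x, f x <= g x) -> integ f <= integ g.
Proof.
move=> cf fr cg gr fg.
by apply: le_Rintegral; [|exact: (compact_support_integrable cf fr)|
  exact: (compact_support_integrable cg gr)|move=> y _; exact: fg].
Qed.

Lemma vanishes_outside_partial r f i : vanishes_outside r f ->
  vanishes_outside r (partial i f).
Proof.
move=> fr x rx; rewrite /partial (@near_eq_derive _ _ _ f (cst 0)) ?derive_cst//.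
near=> y; apply: fr; near: y.
apply: open_nbhs_nbhs; split => //.
apply: (@open_comp 'rV[R]_N R Num.norm [set y : R | r < y]); last exact: open_gt.
by move=> y _; exact: norm_continuous.
Unshelve. all: end_near. Qed.

Lemma integral_partial r i f : continuous f -> vanishes_outside r f ->
  (forall x, derivable f x (delta_mx 0 i)) -> continuous (partial i f) ->
  integ (partial i f) = 0.
Proof.
move=> cf fr df cdf; have dfr := @vanishes_outside_partial r f i fr.
have [M dfM] := compact_support_bounded cdf dfr.
(* The base point has coordinate [i] reset to 0, so the parameter [h] of the line is the coordinate
   itself. *)
have upd t (h : R) : rV_of_tuple (tuple_upd t i h) =
    rV_of_tuple (tuple_upd t i 0) + h *: delta_mx 0 i.
  apply/rowP => j; rewrite !mxE !tnth_mktuple eqxx/=.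
  by case: eqVneq => _; rewrite ?mulr1 ?add0r// mulr0 addr0.
rewrite /integ /Rintegral.
suff -> : (\int[lebesgue_tuple R N]_t ((partial i f \o rV_of_tuple) t)%:E = 0)%E by [].
apply: (@integral_tuple_partial _ _ i (f \o rV_of_tuple) (partial i f \o rV_of_tuple) r M).
- exact: continuous_rV_measurable.
- by move=> t; exact: dfM.
- by move=> t /notin_tuple_box tr; split; [exact: fr|exact: dfr].
- move=> t h /=; rewrite upd; under eq_fun do rewrite upd.
  exact: is_derive_line.
- move=> t; rewrite /comp; under eq_fun do rewrite upd.
  move=> h; apply: (@continuous_comp _ _ _ (fun h : R => rV_of_tuple (tuple_upd t i 0) + h *: delta_mx 0 i)); last exact: cdf.
  apply: cvgD; first exact: cvg_cst.
  by apply: cvgZr_tmp; exact: cvg_id.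
Qed.

End integral_over_space.

(** * First and second order conditions at a maximum *)

Section maximum_principle.
Context {R : realType}.

Lemma difference_quotient_gt0 (f : R -> R) (x l : R) :
  is_derive x 1 f l -> 0 < l ->
  exists2 e : R, 0 < e & forall h, 0 < `|h| < e -> 0 < h^-1 * (f (h + x) - f x).
Proof.
move=> [df <-] l0; have : \forall h \near 0^', 0 < h^-1 *: (f (h *: 1 + x) - f x).
  by apply: (cvgr_gt _ df).
rewrite near_withinE => /nbhs_ballP[e /= e0 He]; exists e => // h /andP[h0 he].
have := He h; rewrite [h *: 1]mulr1; apply; first by rewrite /ball/= sub0r normrN.
by rewrite -normr_gt0.
Qed.

(** Only earlier times are compared, because the maximum over a closed time interval may sit at its
    right end. *)
Lemma derive_ge0_left_max (f : R -> R) (s t l : R) : is_derive t 1 f l -> s < t ->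
  (forall r, s <= r <= t -> f r <= f t) -> 0 <= l.
Proof.
move=> df st fmax; rewrite leNgt; apply/negP => l0.
have dNf : is_derive t 1 (fun r => - f r) (- l) by exact: is_deriveN.
have [|e e0 He] := difference_quotient_gt0 dNf; first by rewrite oppr_gt0.
pose h := Num.min (e / 2) (t - s).
have h0 : 0 < h by rewrite lt_min divr_gt0//= subr_gt0.
have := He (- h); rewrite normrN gtr0_norm// h0/= => /(_ _).
have -> : h < e by rewrite gt_min; apply/orP; left; rewrite ltr_pdivrMr// ltr_pMr// ltr1n.
move=> /(_ isT); rewrite invrN mulNr oppr_gt0 pmulr_rlt0 ?invr_gt0//.
rewrite opprK addrC subr_lt0 ltNge => /negP; apply; apply: fmax.
have : h <= t - s by rewrite ge_min lexx orbT.
lra.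
Qed.

(** Subtracting the quadratic leaves a function [h] with a local maximum at 0, so [h' 0 = 0]. If
    [l > 2 ka], then [h'] is positive just to the right of 0, and the mean value theorem makes [h]
    exceed [h 0] there. *)
Lemma second_derivative_le (g g' : R -> R) (l al ka e : R) : 0 < e ->
  (forall s : R, `|s| < e -> is_derive s 1 g (g' s)) -> is_derive (0 : R) 1 g' l ->
  (forall s, `|s| < e -> g s <= g 0 + al * s + ka * s ^+ 2) -> l <= 2 * ka.
Proof.
move=> e0 dg dg' gle; rewrite leNgt; apply/negP => kal.
pose h s := g s - al * s - ka * s ^+ 2.
pose h' s := g' s - al - 2 * ka * s.
have dh (s : R) : `|s| < e -> is_derive s 1 h (h' s).
  move=> se; have := dg _ se => dgs; rewrite /h /h'.
  by apply: is_derive_eq; rewrite /GRing.scale/= /GRing.scale/=; ring.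
have h'0 : h' 0 = 0.
  have de : - e < e by lra.
  have d0 : is_derive (0 : R) 1 h 0.
    apply: (@derive1_at_max _ h (- e) e); first exact: ltW.
    - by move=> t; rewrite in_itv/= -ltr_norml => te; have := dh _ te => ?; apply: ex_derive.
    - by rewrite in_itv/= oppr_lt0 e0.
    - move=> t; rewrite in_itv/= -ltr_norml => te; have := gle _ te.
      by rewrite /h; lra.
  have := dh 0; rewrite normr0 => /(_ e0) d1.
  by rewrite -(@derive_val _ _ _ _ _ _ _ d1) (@derive_val _ _ _ _ _ _ _ d0).
have dh' : is_derive (0 : R) 1 h' (l - 2 * ka).
  by rewrite /h'; apply: is_derive_eq; rewrite /GRing.scale/=; ring.
have [|d d0 Hd] := difference_quotient_gt0 dh'; first by rewrite subr_gt0.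
pose r := Num.min d e / 2.
have m0 : 0 < Num.min d e by rewrite lt_min d0.
have r0 : 0 < r by rewrite divr_gt0.
have [rd re] : r < d /\ r < e.
  by split; rewrite ltr_pdivrMr// (@lt_le_trans _ _ (2 * Num.min d e)) ?ltr_pMl ?ltr1n// mulrC ler_pM2r// ge_min lexx ?orbT.
have small s : 0 <= s <= r -> `|s| < e.
  by move=> /andP[s0 sr]; rewrite ger0_norm//; exact: le_lt_trans re.
have [||c] := @MVT _ h h' 0 r r0.
- by move=> s; rewrite in_itv/= => /andP[s0 sr]; apply/dh/small; rewrite !ltW.
- apply: derivable_within_continuous => s; rewrite in_itv/= => /small se.
  by have := dh _ se => ?; apply: ex_derive.
rewrite in_itv/= => /andP[c0 cr] hE.
have : 0 < h' c.
  have := Hd c; rewrite gtr0_norm// c0 (lt_trans cr rd) => /(_ isT).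
  by rewrite addr0 h'0 subr0 pmulr_rgt0// invr_gt0.
rewrite subr0 in hE; move=> h'c; have : 0 < h r - h 0 by rewrite hE mulr_gt0.
have /gle : `|r| < e by apply: small; rewrite lexx ltW.
rewrite /h; lra.
Qed.

Lemma open_line (V : normedModType R) (U : set V) (x v : V) : open U -> U x ->
  exists2 e : R, 0 < e & forall s : R, `|s| < e -> U (x + s *: v).
Proof.
move=> oU Ux; have cl : continuous (fun s : R => x + s *: v).
  by move=> s; apply: cvgD; [exact: cvg_cst|apply: cvgZr_tmp; exact: cvg_id].
have := cl 0 U; rewrite scale0r addr0 => /(_ (open_nbhs_nbhs (conj oU Ux))).
move=> /nbhs_ballP[e /= e0 He]; exists e => // s se.
by apply: He; rewrite /ball/= sub0r normrN.
Qed.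

Variables (N : nat) (Om : set 'rV[R]_N).

(* The comparison function [K (r^2 - x_i0^2) + A] has Laplacian [- 2 K]. *)
Definition parabola (i0 : 'I_N) (K r A : R) (x : 'rV[R]_N) : R :=
  K * (r ^+ 2 - x 0 i0 ^+ 2) + A.

(** On each coordinate line through [x], maximality bounds [f] by a quadratic whose leading
    coefficient is [- K] in the direction [i0] and 0 in the others. *)
Lemma laplacian_le_at_max (f : 'rV[R]_N -> R) (i0 : 'I_N) (K r A : R) (x : 'rV[R]_N) :
  open Om -> Om x -> (forall y i, Om y -> derivable f y (delta_mx 0 i)) ->
  (forall i, derivable (partial i f) x (delta_mx 0 i)) ->
  (forall y, Om y -> f y - parabola i0 K r A y <= f x - parabola i0 K r A x) ->
  laplacian f x <= - (2 * K).
Proof.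
move=> oO Ox df d2f fmax.
suff H i : partial i (partial i f) x <= if i == i0 then - (2 * K) else 0.
  rewrite /laplacian (bigD1 i0)//= -[leRHS]addr0 lerD//.
    by have := H i0; rewrite eqxx.
  by apply: sumr_le0 => i ii0; have := H i; rewrite (negbTE ii0).
have [e e0 He] := open_line (delta_mx 0 i) oO Ox.
have xs (s : R) : (x + s *: delta_mx 0 i) 0 i0 = x 0 i0 + s * (i == i0)%:R.
  by rewrite !mxE eqxx eq_sym.
suff : partial i (partial i f) x <= 2 * (if i == i0 then - K else 0).
  by case: ifP => _; rewrite ?mulr0 ?mulrN.
apply: (@second_derivative_le (fun s => f (x + s *: delta_mx 0 i))
  (fun s => partial i f (x + s *: delta_mx 0 i)) _
  (if i == i0 then - (2 * K * x 0 i0) else 0) _ e) => //.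
- by move=> s se; apply: is_derive_line; exact/df/He.
- by have := @is_derive_line _ _ _ (partial i f) x (delta_mx 0 i) 0;
    rewrite scale0r addr0; apply.
- move=> s se; have := fmax _ (He _ se).
  rewrite scale0r addr0 /parabola xs; case: eqVneq => _; rewrite ?mulr1 ?mulr0; lra.
Qed.

End maximum_principle.

(** * Uniform bound for two components coupled by exchange *)

Section cooperative_systems.
Context {R : realType} {N : nat} (Om : set 'rV[R]_N) (T : \bar R).
Implicit Types v z : R -> 'rV[R]_N -> R.

(** Incompatible signs: at such a maximum the time derivative is nonnegative, the diffusion
    contributes at least [2 b K] on the left of the equation, and the coupling is nonpositive
    because [z <= v] there; hence [2 b K <= kap]. *)
Lemma no_interior_max v z (b D K r A kap s t1 : R) (i0 : 'I_N) x1 :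
  open Om -> C12 Om T v -> 0 < b -> 0 < D -> kap < 2 * b * K ->
  0 < s < t1 -> (t1%:E < T)%E -> Om x1 ->
  time_derivative v t1 x1 - b * laplacian (v t1) x1
    <= kap + D * (z t1 x1 - v t1 x1) ->
  z t1 x1 <= v t1 x1 ->
  ~ (forall t x, s <= t <= t1 -> Om x ->
      v t x - parabola i0 K r A x <= v t1 x1 - parabola i0 K r A x1).
Proof.
move=> oO Cv b0 D0 kapK /andP[s0 st] tT Ox pde zv vmax.
have t0 : 0 < t1 by exact: lt_trans st.
have tge0 : 0 <= time_derivative v t1 x1.
  apply: (@derive_ge0_left_max _ (v ^~ x1) s t1) => //.
    by rewrite /time_derivative derive1E; apply: derivableP; have [] := Cv _ _ t0 tT Ox.
  by move=> t st1; have := vmax _ _ st1 Ox; rewrite lerD2r.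
have : laplacian (v t1) x1 <= - (2 * K).
  apply: (laplacian_le_at_max (i0 := i0) (r := r) (A := A) oO Ox).
  - by move=> y i Oy; have [_ _ /(_ i)[]] := Cv _ _ t0 tT Oy.
  - by move=> i; have [_ _ _ /(_ i i)[]] := Cv _ _ t0 tT Ox.
  - by move=> y Oy; apply: vmax => //; rewrite lexx ltW.
move=> lap; have : b * laplacian (v t1) x1 <= b * (- (2 * K)) by rewrite ler_pM2l.
have : D * (z t1 x1 - v t1 x1) <= 0 by rewrite pmulr_rle0// subr_le0.
lra.
Qed.

Lemma cooperative_bounded v z (v0 z0 : 'rV[R]_N -> R) (b d D D' kap s : R) (i0 : 'I_N) :
  open Om -> bounded_set Om ->
  classical_component Om T v0 v -> classical_component Om T z0 z ->
  0 < b -> 0 < d -> 0 < D -> 0 < D' -> 0 < s -> (s%:E < T)%E ->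
  (forall t x, 0 < t -> (t%:E < T)%E -> Om x -> 1 <= v t x ->
    time_derivative v t x - b * laplacian (v t) x <= kap + D * (z t x - v t x)) ->
  (forall t x, 0 < t -> (t%:E < T)%E -> Om x -> 1 <= z t x ->
    time_derivative z t x - d * laplacian (z t) x <= kap + D' * (v t x - z t x)) ->
  exists M, forall t x, s <= t -> (t%:E < T)%E -> Om x -> v t x <= M /\ z t x <= M.
Proof.
move=> oO [r0 [_ Obd]] Cv Cz b0 d0 D0 D'0 s0 sT pdev pdez.
have := Obd (`|r0| + 1); rewrite (le_lt_trans (ler_norm _)) ?ltrDl// => /(_ isT).
set r := _ + 1 => Or; have r_gt0 : 0 < r by rewrite ltr_wpDl.
have cOr : closure Om `<=` [set x : 'rV[R]_N | `|x| <= r].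
  rewrite closureE => x; apply; split; last exact: Or.
  rewrite (_ : mkset _ = Num.norm @^-1` [set y : R | y <= r])//.
  by apply: closed_comp; [move=> y _; exact: norm_continuous|exact: closed_le].
have [Mv HMv] := component_bounded Cv sT.
have [Mz HMz] := component_bounded Cz sT.
(* [A] places the parabola above both components at time [s] and above 1, where the differential
   inequalities are assumed; [K] gives [kap < 2 b K] and [kap < 2 d K] at once. *)
pose A := 1 + `|Mv| + `|Mz|; pose K := (`|kap| + 1) / b + (`|kap| + 1) / d.
have K0 : 0 < K by rewrite addr_gt0// divr_gt0// ltr_wpDl.
have A1 : 1 <= A by rewrite /A -addrA lerDl addr_ge0.
pose psi := parabola i0 K r A.
have psi_ge x : closure Om x -> A <= psi x.
  move=> /cOr/= xr; rewrite lerDr mulr_ge0 ?(ltW K0)// subr_ge0.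
  by rewrite -(real_normK (num_real (x 0 i0))) lerXn2r ?nnegrE ?(ltW r_gt0)// (le_trans (coord_le_norm _ _)).
have psi_le x : psi x <= K * r ^+ 2 + A.
  by rewrite lerD2r ler_pM2l// gerBl sqr_ge0.
have kapK x : 0 < x -> (`|kap| + 1) / x <= K -> kap < 2 * x * K.
  move=> x0 xK; apply: (@lt_le_trans _ _ (2 * (`|kap| + 1))).
    have := ler_norm kap; have := normr_ge0 kap; lra.
  by rewrite -mulrA ler_pM2l// mulrC -ler_pdivrMr.
have kapb : kap < 2 * b * K by apply: kapK => //; rewrite lerDl divr_ge0 ?ltW// addr_ge0.
have kapd : kap < 2 * d * K by apply: kapK => //; rewrite lerDr divr_ge0 ?ltW// addr_ge0.
have psi_cont : continuous psi.
  have cq : continuous (fun y : R => K * (r ^+ 2 - y ^+ 2) + A).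
    move=> y; apply: cvgD; last exact: cvg_cst.
    apply: cvgM; first exact: cvg_cst.
    apply: cvgB; first exact: cvg_cst.
    exact: exprn_continuous.
  move=> x; apply: (@continuous_comp _ _ _ (fun x : 'rV[R]_N => x 0 i0) (fun y : R => K * (r ^+ 2 - y ^+ 2) + A)); last exact: cq.
  exact: coord_continuous.
exists (K * r ^+ 2 + A) => t0 x0 st0 t0T Ox0.
(* Starting at [s > 0] keeps this compact set inside the region where the components are known to be
   continuous up to the boundary. *)
pose Q := [set` `[s, t0]] `*` closure Om.
have cQ : compact Q.
  apply: compact_setX; first exact: segment_compact.
  apply: bounded_closed_compact; last exact: closed_closure.
  exists r; split; [exact: num_real|move=> q rq x /cOr /= /le_trans; apply; exact: ltW].
have Q0 : Q (t0, x0).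
  by split => /=; [rewrite in_itv/= st0 lexx|exact: subset_closure].
have QS : Q `<=` [set p : R * 'rV[R]_N | [/\ 0 < p.1, (p.1%:E < T)%E & closure Om p.2]].
  move=> [t x] [/=]; rewrite in_itv/= => /andP[st tt0] cx; split => //.
    exact: lt_le_trans st.
  by apply: le_lt_trans t0T; rewrite lee_fin.
have maxQ y y0 : classical_component Om T y0 y -> exists t1 x1, Q (t1, x1) /\
    forall t x, Q (t, x) -> y t x - psi x <= y t1 x1 - psi x1.
  move=> Cy; have [||[t1 x1] tx Hmax] := @compact_EVT_max _ R (fun p : R * 'rV[R]_N => y p.1 p.2 - psi p.2) Q _ cQ.
  - by exists (t0, x0).
  - move=> p; apply: cvgB; first exact: (continuous_subspaceW QS (component_continuous Cy)).
    apply: (@continuous_subspaceT _ _ Q (fun p : R * 'rV[R]_N => psi p.2)).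
    by move=> q; apply: (@continuous_comp _ _ _ snd psi); [exact: cvg_snd|exact: psi_cont].
  exists t1, x1; split; first by rewrite inE in tx.
  by move=> t x Qtx; apply: (Hmax (t, x)); rewrite inE.
have [tv [xv [Qv vmax]]] := maxQ _ _ Cv.
have [tz [xz [Qz zmax]]] := maxQ _ _ Cz.
(* A positive maximum avoids the boundary, where the component is 0, and the time [s], where it is
   at most [A]; in both places the parabola is at least [A]. *)
have interior y y0 My t1 x1 : classical_component Om T y0 y -> My <= A ->
    (forall t x, 0 <= t <= s -> Om x -> `|y t x| <= My) ->
    Q (t1, x1) -> 0 < y t1 x1 - psi x1 -> [/\ 0 < s < t1, (t1%:E < T)%E, Om x1 & 1 <= y t1 x1].
  move=> Cy MyA HMy Q1 ypos; have [t1_gt0 t1T /= cx1] := QS _ Q1.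
  have [/= + _] := Q1; rewrite in_itv/= => /andP[st1 _].
  have psi1 := psi_ge _ cx1.
  have Ox1 : Om x1.
    apply: contrapT => Ox1; have : y t1 x1 = 0.
      by apply: (component_dirichlet Cy) => //; split => //; rewrite (iffLR (interior_id _) oO).
    by move: ypos => /[swap] ->; lra.
  split => //; last lra.
  rewrite s0/= lt_neqAle st1 andbT; apply/eqP => ts; subst t1.
  have := HMy s x1; rewrite lexx ltW// => /(_ isT Ox1) /(le_trans (ler_norm _)); lra.
have MvA : Mv <= A by have := ler_norm Mv; have := normr_ge0 Mz; rewrite /A; lra.
have MzA : Mz <= A by have := ler_norm Mz; have := normr_ge0 Mv; rewrite /A; lra.
have le_t1 t1 t x x1 : Q (t1, x1) -> s <= t <= t1 -> Om x -> Q (t, x).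
  move=> [/= + _]; rewrite in_itv/= => /andP[_ t1t0] /andP[st tt1] Ox; split => /=.
    by rewrite in_itv/= st (le_trans tt1).
  exact: subset_closure.
(* At the point where the larger of the two maxima is reached, the other component is not larger;
   this fixes the sign of the coupling. *)
have [vz|zv] := leP (z tz xz - psi xz) (v tv xv - psi xv).
- have [vle|vpos] := leP (v tv xv - psi xv) 0.
    have := vmax _ _ Q0; have := zmax _ _ Q0; have := psi_le x0; lra.
  exfalso; have [st1 t1T Ox1 v1] := interior _ _ _ _ _ Cv MvA HMv Qv vpos.
  have t1_gt0 : 0 < tv by case/andP: st1; exact: lt_trans.
  apply: (no_interior_max (z := z) (i0 := i0) (r := r) (A := A) oO (component_C12 Cv) b0 D0 kapb st1 t1T Ox1).
  + exact: pdev.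
  + have := zmax _ _ Qv; lra.
  + by move=> t x tt1 Ox; apply: vmax; exact: le_t1 Qv tt1 Ox.
- have [zle|zpos] := leP (z tz xz - psi xz) 0.
    have := vmax _ _ Q0; have := zmax _ _ Q0; have := psi_le x0; lra.
  exfalso; have [st1 t1T Ox1 v1] := interior _ _ _ _ _ Cz MzA HMz Qz zpos.
  have t1_gt0 : 0 < tz by case/andP: st1; exact: lt_trans.
  apply: (no_interior_max (z := v) (i0 := i0) (r := r) (A := A) oO (component_C12 Cz) d0 D'0 kapd st1 t1T Ox1).
  + exact: pdez.
  + have := vmax _ _ Qz; lra.
  + by move=> t x tt1 Ox; apply: zmax; exact: le_t1 Qz tt1 Ox.
Qed.

End cooperative_systems.

(** * Extension by zero of functions that vanish where [u] is small *)

Section extension_by_zero.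
Context {R : realType}.

Lemma is_derive_of_line (V W : normedModType R) (f : V -> W) (x v : V) (l : W) :
  is_derive (0 : R) 1 (fun s : R => f (x + s *: v)) l -> is_derive x v f l.
Proof.
have E : (fun k : R => k^-1 *: ((fun s : R => f (x + s *: v)) (k *: 1 + 0)
    - f (x + (0 : R) *: v))) =
  (fun k => k^-1 *: (f (k *: v + x) - f x)).
  apply/funext => k; congr (_ *: (f _ - f _)).
    by rewrite addr0 [k *: 1]mulr1 addrC.
  by rewrite scale0r addr0.
by move=> [df <-]; apply: DeriveDef; rewrite /derivable /derive -E.
Qed.

Lemma is_derive_comp_dir (V : normedModType R) (f : R -> R) (u : V -> R)
    (x v : V) (du l : R) :
  is_derive x v u du -> is_derive (u x) 1 f l ->
  is_derive x v (fun y => f (u y)) (l * du).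
Proof.
move=> du0 dfl; apply: is_derive_of_line.
have dline : is_derive (0 : R) 1 (fun s : R => u (x + s *: v)) du.
  have := @is_derive_line R V R u x v 0; rewrite scale0r addr0.
  by rewrite (@derive_val _ _ _ _ _ _ _ du0); apply; apply: ex_derive.
have dfl' : is_derive ((fun s : R => u (x + s *: v)) 0) 1 f l by rewrite scale0r addr0.
by have := @is_derive1_comp R f (fun s : R => u (x + s *: v)) 0 l du dfl' dline; rewrite mulrC.
Qed.

Context {N : nat} (Om : set 'rV[R]_N) (T : \bar R).
Implicit Types (u W : R -> 'rV[R]_N -> R) (f : 'rV[R]_N -> R).

Definition ext0 f x := if x \in Om then f x else 0.

Definition spacetime : set (R * 'rV[R]_N) :=
  [set p | [/\ 0 < p.1, (p.1%:E < T)%E & Om p.2]].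

Definition continuous_in W := forall t x, spacetime (t, x) ->
  {for (t, x), continuous (fun p : R * 'rV[R]_N => W p.1 p.2)}.

(* With [k > 0] and [u = 0] on the boundary, such a [W] has compact support in
   [Om] at each time, so its extension by zero inherits its regularity. *)
Definition vanishes_below (k : R) u W := forall t x, spacetime (t, x) ->
  u t x <= k -> W t x = 0.

Lemma ext0E f x : Om x -> ext0 f x = f x.
Proof. by move=> Ox; rewrite /ext0 mem_set. Qed.

Lemma ext0N f x : ~ Om x -> ext0 f x = 0.
Proof. by move=> Ox; rewrite /ext0 memNset. Qed.

Lemma later_time (t : R) : (t%:E < T)%E -> exists2 t' : R, t < t' & (t'%:E < T)%E.
Proof.
case: T => [r| |]//; last by exists (t + 1); rewrite ?ltrDl ?ltry.
by rewrite lte_fin => tr; exists ((t + r) / 2); rewrite ?lte_fin; lra.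
Qed.

Lemma near_times (t : R) : 0 < t -> (t%:E < T)%E ->
  \forall s \near t, 0 < s /\ (s%:E < T)%E.
Proof.
move=> t0 /later_time[t' tt' t'T]; near=> s; split.
  by near: s; exact: lt_nbhsr.
apply: lt_trans t'T; rewrite lte_fin; near: s; exact: lt_nbhsl.
Unshelve. all: end_near. Qed.

Hypothesis oO : open Om.

Lemma spacetime_nbhs t x : spacetime (t, x) -> nbhs (t, x) spacetime.
Proof.
move=> [/= t0 tT Ox]; exists ([set s | 0 < s /\ (s%:E < T)%E], Om).
  by split => /=; [exact: near_times|exact: open_nbhs_nbhs].
by move=> [s y] [/= [? ?] ?].
Qed.

Variables (u : R -> 'rV[R]_N -> R) (u0 : 'rV[R]_N -> R) (k : R).
Hypotheses (Cu : classical_component Om T u0 u) (k0 : 0 < k).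

Lemma component_continuous_in : continuous_in u.
Proof.
move=> t x tx; have [/= t0 tT Ox] := tx.
set S := [set p : R * 'rV[R]_N | [/\ 0 < p.1, (p.1%:E < T)%E & closure Om p.2]].
have Sint : S^° (t, x).
  apply: filterS (spacetime_nbhs tx) => -[s y] [/= s0 sT Oy]; split => //.
  exact: subset_closure.
have := component_continuous Cu; rewrite -/S => /subspace_continuousP/(_ (t, x)).
by rewrite within_interior//; apply; split => //=; exact: subset_closure.
Qed.

(** Outside the closure of [Om] a whole neighbourhood misses [Om]. At a boundary point [u = 0 < k],
    and continuity up to the boundary keeps [u] below [k] nearby, so [W] vanishes at the
    neighbouring points of [Om]. *)
Lemma ext0_near0 W (t : R) x : vanishes_below k u W -> 0 < t -> (t%:E < T)%E -> ~ Om x ->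
  \forall p \near (t, x), ext0 (W p.1) p.2 = 0.
Proof.
move=> Wk t0 tT Ox; have [cx|ncx] := pselect (closure Om x); last first.
  have ncO : nbhs x (~` closure Om).
    by apply: open_nbhs_nbhs; split => //; exact/closed_openC/closed_closure.
  exists ([set: R], ~` closure Om); first by split => //=; exact: filterT.
  by move=> [s y] [_ /= ny]; apply: ext0N => Oy; apply/ny/subset_closure.
set S := [set p : R * 'rV[R]_N | [/\ 0 < p.1, (p.1%:E < T)%E & closure Om p.2]].
have utx : u t x = 0.
  by apply: (component_dirichlet Cu) => //; split => //; rewrite (iffLR (interior_id _) oO).
have := component_continuous Cu; rewrite -/S => /subspace_continuousP/(_ (t, x)).
move=> /(_ (And3 t0 tT cx)) Hc.
have uk : \forall p \near within S (nbhs (t, x)), u p.1 p.2 < k.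
  by apply: (cvgr_lt _ Hc); rewrite /from_subspace /= utx.
have tn : \forall p \near (t, x), 0 < p.1 /\ (p.1%:E < T)%E.
  exists ([set s : R | 0 < s /\ (s%:E < T)%E], setT) => /=.
    by split; [exact: near_times|exact: filterT].
  by move=> [s y] [].
apply: filterS2 tn uk => -[s y] /= [s0 sT] uk.
have [Oy|/ext0N//] := pselect (Om y); rewrite ext0E//; apply: Wk; first by [].
by apply/ltW/uk; split => //; exact: subset_closure.
Qed.

Lemma ext0_continuous W (t : R) x : vanishes_below k u W -> continuous_in W ->
  0 < t -> (t%:E < T)%E ->
  {for (t, x), continuous (fun p : R * 'rV[R]_N => ext0 (W p.1) p.2)}.
Proof.
move=> Wk cW t0 tT; have [Ox|Ox] := pselect (Om x).
  have tx : spacetime (t, x) by [].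
  rewrite /prop_for /continuous_at /= ext0E//.
  apply: cvg_trans (cW _ _ tx); apply: near_eq_cvg.
  by apply: filterS (spacetime_nbhs tx) => -[s y] [/= _ _ Oy]; rewrite ext0E.
rewrite /prop_for /continuous_at /= ext0N//.
apply: cvg_near_cst; exact: ext0_near0.
Qed.

Lemma cvg_slice (t : R) (x : 'rV[R]_N) : (fun y : 'rV[R]_N => (t, y)) @ x --> (t, x).
Proof.
move=> P [[A B] [/= At Bx] AB].
by apply: (@filterS _ _ (nbhs_filter x) _ _ _ Bx) => y By; apply: AB; split => //=; exact: nbhs_singleton At.
Qed.

Lemma ext0_continuous_slice W (t : R) : vanishes_below k u W -> continuous_in W ->
  0 < t -> (t%:E < T)%E -> continuous (ext0 (W t)).
Proof.
move=> Wk cW t0 tT x.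
apply: (@continuous_comp _ _ _ (fun y : 'rV[R]_N => (t, y)) (fun p : R * 'rV[R]_N => ext0 (W p.1) p.2)).
  exact: cvg_slice.
exact: ext0_continuous.
Qed.

Lemma ext0_near0_slice W (t : R) x : vanishes_below k u W -> 0 < t -> (t%:E < T)%E -> ~ Om x ->
  \forall y \near x, ext0 (W t) y = 0.
Proof.
move=> Wk t0 tT /(ext0_near0 Wk t0 tT) H.
exact: (cvg_slice H).
Qed.

(** The extension of [h] is differentiable on the whole space with derivative the extension of [dh],
    since both vanish near every point outside [Om]; the divergence theorem is then that of
    compactly supported functions. *)
Lemma integral_ext0_partial (r : R) h dh (i : 'I_N) (t : R) :
  (forall x, Om x -> `|x| <= r) ->
  vanishes_below k u h -> continuous_in h ->
  vanishes_below k u dh -> continuous_in dh ->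
  (forall x, Om x -> is_derive x (delta_mx 0 i) (h t) (dh t x)) ->
  0 < t -> (t%:E < T)%E -> integ (ext0 (dh t)) = 0.
Proof.
move=> Or hk ch dhk cdh dh_ t0 tT.
have der x : is_derive x (delta_mx 0 i) (ext0 (h t)) (ext0 (dh t) x).
  have [Ox|Ox] := pselect (Om x).
    rewrite ext0E//; apply: near_eq_is_derive (dh_ _ Ox).
    by apply: filterS (open_nbhs_nbhs (conj oO Ox)) => y Oy; rewrite ext0E.
  rewrite ext0N//; apply: (@near_eq_is_derive _ _ _ (cst 0)).
    by apply: filterS (ext0_near0_slice hk t0 tT Ox) => y ->.
have dhE : partial i (ext0 (h t)) = ext0 (dh t).
  by apply/funext => x; exact: derive_val.
rewrite -dhE; apply: (@integral_partial _ _ r).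
- exact: ext0_continuous_slice.
- by move=> x rx; apply: ext0N => /Or; rewrite leNgt rx.
- by move=> x; apply: ex_derive.
- by rewrite dhE; exact: ext0_continuous_slice.
Qed.

End extension_by_zero.

(** * Differentiation in time under the integral *)

Section integral_time_derivative.
Context {R : realType} {N : nat} (Om : set 'rV[R]_N) (T : \bar R).
Variables (u : R -> 'rV[R]_N -> R) (u0 : 'rV[R]_N -> R) (k r : R).
Hypotheses (oO : open Om) (Or : forall x, Om x -> `|x| <= r).
Hypotheses (Cu : classical_component Om T u0 u) (k0 : 0 < k).

Lemma ext0_vanishes_outside (f : 'rV[R]_N -> R) : vanishes_outside r (ext0 Om f).
Proof. by move=> x rx; apply: ext0N => /Or; rewrite leNgt rx. Qed.

(** The extension of [W'] is continuous, hence bounded, on a compact time interval around [t] times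
    a ball; a constant times the indicator of a box dominates it. The interval starts at [t / 2] to
    stay away from time 0. *)
Lemma integral_ext0_is_derive (W W' : R -> 'rV[R]_N -> R) (t : R) :
  vanishes_below Om T k u W -> continuous_in Om T W ->
  vanishes_below Om T k u W' -> continuous_in Om T W' ->
  (forall (s : R) x, spacetime Om T (s, x) -> is_derive s 1 (W ^~ x) (W' s x)) ->
  0 < t -> (t%:E < T)%E ->
  is_derive t 1 (fun s => integ (ext0 Om (W s))) (integ (ext0 Om (W' t))).
Proof.
move=> Wk cW W'k cW' dW t0 tT; have [t' tt' t'T] := later_time tT.
pose K := [set` `[t / 2, t']] `*` [set x : 'rV[R]_N | `|x| <= r].
have cK : compact K.
  apply: compact_setX; first exact: segment_compact.
  apply: bounded_closed_compact.
    by exists r; split; [exact: num_real|move=> s rs x /= /le_trans; apply; exact: ltW].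
  rewrite (_ : mkset _ = Num.norm @^-1` [set y : R | y <= r])//.
  by apply: closed_comp; [move=> x _; exact: norm_continuous|exact: closed_le].
have times s : t / 2 <= s <= t' -> 0 < s /\ (s%:E < T)%E.
  move=> /andP[s1 s2]; split; first by rewrite (lt_le_trans _ s1)// divr_gt0.
  by apply: le_lt_trans t'T; rewrite lee_fin.
have cWK : {within K, continuous (fun p : R * 'rV[R]_N => ext0 Om (W' p.1) p.2)}.
  apply: continuous_in_subspaceT => -[s x]; rewrite inE => -[/=].
  by rewrite in_itv/= => /times[s0 sT] _; exact: (ext0_continuous oO Cu k0 W'k cW').
have /compact_bounded[M [_ HM]] := continuous_compact cWK cK.
pose M' := `|M| + 1.
have bnd s x : t / 2 <= s <= t' -> `|ext0 Om (W' s) x| <= M' * \1_(tuple_box r) [tuple x 0 i | i < N].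
  move=> st; have [xr|xr] := leP `|x| r; last first.
    by rewrite ext0_vanishes_outside// normr0 mulr_ge0// addr_ge0.
  rewrite indicE mem_set ?mulr1; last first.
    by move=> i; rewrite tnth_mktuple (le_trans (coord_le_norm _ _)).
  apply: (HM M'); first by rewrite (le_lt_trans (ler_norm _))// ltrDl.
  by exists (s, x) => //; split => //=; rewrite in_itv.
pose f s y := ext0 Om (W s) (rV_of_tuple y).
have rVK (y : N.-tuple (measurableTypeR R)) : [tuple (rV_of_tuple y) 0 i | i < N] = y.
  by apply: eq_from_tnth => i; rewrite tnth_mktuple mxE.
have df s y : 0 < s -> (s%:E < T)%E -> is_derive s 1 (f ^~ y) (ext0 Om (W' s) (rV_of_tuple y)).
  move=> s0 sT; have [Ox|Ox] := pselect (Om (rV_of_tuple y)).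
    rewrite ext0E//; under eq_fun do rewrite /f ext0E//.
    by apply: dW.
  by rewrite ext0N//; under eq_fun do rewrite /f ext0N//; exact: is_derive_cst.
have tI : [set` `]t / 2, t'[] t.
  by rewrite /= in_itv/= tt' andbT ltr_pdivrMr// ltr_pMr// ltr1n.
have itvw (s : R) : [set` `]t / 2, t'[] s -> t / 2 <= s <= t'.
  by rewrite /= in_itv/= => /andP[? ?]; rewrite !ltW.
have intf s : [set` `]t / 2, t'[] s -> (lebesgue_tuple R N).-integrable setT (EFin \o f s).
  move=> /itvw/times[s0 sT].
  apply: (@compact_support_integrable R N r); first exact: (ext0_continuous_slice oO Cu k0 Wk cW).
  exact: ext0_vanishes_outside.
have derf s y : [set` `]t / 2, t'[] s -> [set: N.-tuple (measurableTypeR R)] y -> derivable (f ^~ y) s 1.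
  by move=> /itvw/times[s0 sT] _; have ? := df s y s0 sT; exact: ex_derive.
have dfE s y : 0 < s -> (s%:E < T)%E -> partial1of2 f s y = ext0 Om (W' s) (rV_of_tuple y).
  by move=> s0 sT; have ? := df s y s0 sT; rewrite partial1of2E; exact: derive_val.
pose G (y : N.-tuple (measurableTypeR R)) : R := M' * \1_(tuple_box r) y.
have G0 y : 0 <= G y by rewrite mulr_ge0// addr_ge0.
have iG : (lebesgue_tuple R N).-integrable setT (EFin \o G).
  apply: (@bounded_support_integrable _ _ _ _ (tuple_box r) _ M').
  - exact: tuple_box_measurable.
  - exact: lebesgue_tuple_box_lty.
  - apply: measurable_funM; first exact: measurable_cst.
    by apply: measurable_indic; exact: tuple_box_measurable.
  - move=> y; rewrite ger0_norm// /G indicE; case: (_ \in _); rewrite ?mulr1// mulr0.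
    by rewrite addr_ge0.
  - by move=> y yr; rewrite /G indicE memNset// mulr0.
have Gub s y : [set` `]t / 2, t'[] s -> [set: N.-tuple (measurableTypeR R)] y -> `|partial1of2 f s y| <= G y.
  move=> /itvw st _; have [s0 sT] := times _ st.
  by rewrite dfE// (le_trans (bnd _ _ st))// rVK.
have -> : integ (ext0 Om (W' t)) = \int[lebesgue_tuple R N]_y partial1of2 f t y.
  by apply: eq_Rintegral => y _; rewrite dfE.
apply: DeriveDef.
  exact: (derivable_under_integral measurableT tI intf derf G0 iG Gub).
rewrite -derive1E.
exact: (differentiation_under_integral measurableT tI intf derf G0 iG Gub).
Qed.

End integral_time_derivative.

(** * Stability of space-time continuity *)

Section continuous_in_theory.
Context {R : realType} {N : nat} (Om : set 'rV[R]_N) (T : \bar R).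
Implicit Types W Z : R -> 'rV[R]_N -> R.

Lemma continuous_inD W Z : continuous_in Om T W -> continuous_in Om T Z ->
  continuous_in Om T (fun t x => W t x + Z t x).
Proof. by move=> cW cZ t x tx; apply: cvgD; [exact: cW|exact: cZ]. Qed.

Lemma continuous_inM W Z : continuous_in Om T W -> continuous_in Om T Z ->
  continuous_in Om T (fun t x => W t x * Z t x).
Proof. by move=> cW cZ t x tx; apply: cvgM; [exact: cW|exact: cZ]. Qed.

Lemma continuous_in_sqr W : continuous_in Om T W ->
  continuous_in Om T (fun t x => W t x ^+ 2).
Proof. by move=> cW t x tx; apply: cvgM; exact: cW. Qed.

Lemma continuous_in_cst (c : R) : continuous_in Om T (fun _ _ => c).
Proof. by move=> t x tx; exact: cvg_cst. Qed.

Lemma continuous_inB W Z : continuous_in Om T W -> continuous_in Om T Z ->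
  continuous_in Om T (fun t x => W t x - Z t x).
Proof. by move=> cW cZ t x tx; apply: cvgB; [exact: cW|exact: cZ]. Qed.

Lemma continuous_in_sum (I : Type) (s : seq I) (F : I -> R -> 'rV[R]_N -> R) :
  (forall i, continuous_in Om T (F i)) ->
  continuous_in Om T (fun t x => \sum_(i <- s) F i t x).
Proof.
move=> cF; elim: s => [|i s IH] t x tx.
  rewrite /prop_for /continuous_at big_nil; under eq_fun do rewrite big_nil.
  exact: cvg_cst.
rewrite /prop_for /continuous_at big_cons; under eq_fun do rewrite big_cons.
by apply: cvgD; [exact: cF|exact: IH].
Qed.

Lemma continuous_in_comp (f : R -> R) W : continuous_in Om T W ->
  (forall t x, spacetime Om T (t, x) -> {for W t x, continuous f}) ->
  continuous_in Om T (fun t x => f (W t x)).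
Proof.
move=> cW cf t x tx.
apply: (@continuous_comp _ _ _ (fun p : R * 'rV[R]_N => W p.1 p.2) f); first exact: cW.
exact: cf.
Qed.

Lemma is_derive_continuous (f : R -> R) (x l : R) :
  is_derive x 1 f l -> {for x, continuous f}.
Proof.
by move=> df; apply: differentiable_continuous; apply/derivable1_diffP; apply: ex_derive.
Qed.

Variables (u : R -> 'rV[R]_N -> R) (k : R).

Lemma vanishes_below_sum (I : Type) (s : seq I) (F : I -> R -> 'rV[R]_N -> R) :
  (forall i, vanishes_below Om T k u (F i)) ->
  vanishes_below Om T k u (fun t x => \sum_(i <- s) F i t x).
Proof. by move=> Fk t x tx utx; apply: big1 => i _; exact: Fk. Qed.

End continuous_in_theory.

(** * The energy inequality for a general truncation [xi] and weight [ph] *)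

Section energy.
Context {R : realType} {N : nat} (Om : set 'rV[R]_N) (T : \bar R).
Variables (u v : R -> 'rV[R]_N -> R) (u0 v0 : 'rV[R]_N -> R) (k r a b : R).
Hypotheses (oO : open Om) (Or : forall x, Om x -> `|x| <= r).
Hypotheses (Cu : classical_component Om T u0 u) (Cv : classical_component Om T v0 v).
Hypotheses (k0 : 0 < k).
Variables (xi xi' xi'' ph ph' ph'' : R -> R).
Hypotheses (dxi : forall x : R, is_derive x 1 xi (xi' x))
  (dxi' : forall x : R, is_derive x 1 xi' (xi'' x)) (cxi'' : continuous xi'').
Hypothesis xi_vanish : forall x, x <= k -> [/\ xi x = 0, xi' x = 0 & xi'' x = 0].
Hypotheses (dph : forall x : R, 0 <= x -> is_derive x 1 ph (ph' x))
  (dph' : forall x : R, 0 <= x -> is_derive x 1 ph' (ph'' x))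
  (cph'' : forall x : R, 0 <= x -> {for x, continuous ph''}).

Let cu : continuous_in Om T u := component_continuous_in oO Cu.
Let cv : continuous_in Om T v := component_continuous_in oO Cv.

Let v_ge0 t x : spacetime Om T (t, x) -> 0 <= v t x.
Proof. by move=> [/= t0 tT Ox]; apply: (component_ge0 Cv) => //; exact: ltW. Qed.

Let cxi : continuous_in Om T (fun t x => xi (u t x)).
Proof. by apply: continuous_in_comp => // t x _; exact: is_derive_continuous. Qed.

Let cxi' : continuous_in Om T (fun t x => xi' (u t x)).
Proof. by apply: continuous_in_comp => // t x _; exact: is_derive_continuous. Qed.

Let cxi2 : continuous_in Om T (fun t x => xi'' (u t x)).
Proof. by apply: continuous_in_comp => // t x _; exact: cxi''. Qed.

Let cph : continuous_in Om T (fun t x => ph (v t x)).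
Proof.
by apply: continuous_in_comp => // t x /v_ge0 /dph; exact: is_derive_continuous.
Qed.

Let cph' : continuous_in Om T (fun t x => ph' (v t x)).
Proof.
by apply: continuous_in_comp => // t x /v_ge0 /dph'; exact: is_derive_continuous.
Qed.

Let cph2 : continuous_in Om T (fun t x => ph'' (v t x)).
Proof. by apply: continuous_in_comp => // t x /v_ge0; exact: cph''. Qed.

Let ct w0 w : classical_component Om T w0 w -> continuous_in Om T (time_derivative w).
Proof. by move=> Cw t x [/= t0 tT Ox]; have [] := component_C12 Cw t0 tT Ox. Qed.

Let c1 w0 w i : classical_component Om T w0 w ->
  continuous_in Om T (fun t => partial i (w t)).
Proof. by move=> Cw t x [/= t0 tT Ox]; have [_ _ /(_ i)[]] := component_C12 Cw t0 tT Ox. Qed.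

Let c2 w0 w i : classical_component Om T w0 w ->
  continuous_in Om T (fun t => partial i (partial i (w t))).
Proof. by move=> Cw t x [/= t0 tT Ox]; have [_ _ _ /(_ i i)[]] := component_C12 Cw t0 tT Ox. Qed.

Definition energy_density t x := xi (u t x) * ph (v t x).

Definition energy_density_t t x :=
  xi' (u t x) * ph (v t x) * time_derivative u t x +
  xi (u t x) * ph' (v t x) * time_derivative v t x.

Definition energy t := integ (ext0 Om (energy_density t)).

(** The time derivative of the density with the diffusion removed: along a solution both brackets
    are reaction terms. *)
Definition energy_source t x :=
  xi' (u t x) * ph (v t x) * (time_derivative u t x - a * laplacian (u t) x) +
  xi (u t x) * ph' (v t x) * (time_derivative v t x - b * laplacian (v t) x).

(** The field whose divergence contains all second-order terms of [energy_density_t]; it vanishes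
    where [xi] and [xi'] do. *)
Definition flux i t x :=
  a * (xi' (u t x) * ph (v t x) * partial i (u t) x) +
  b * (xi (u t x) * ph' (v t x) * partial i (v t) x).

Definition flux_partial i t x :=
  a * (xi'' (u t x) * ph (v t x) * partial i (u t) x ^+ 2
       + xi' (u t x) * ph' (v t x) * (partial i (u t) x * partial i (v t) x)
       + xi' (u t x) * ph (v t x) * partial i (partial i (u t)) x) +
  b * (xi' (u t x) * ph' (v t x) * (partial i (u t) x * partial i (v t) x)
       + xi (u t x) * ph'' (v t x) * partial i (v t) x ^+ 2
       + xi (u t x) * ph' (v t x) * partial i (partial i (v t)) x).

Lemma energy_density_continuous : continuous_in Om T energy_density.
Proof. exact: continuous_inM. Qed.

Let energy_density_t_continuous : continuous_in Om T energy_density_t.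
Proof.
exact (continuous_inD (continuous_inM (continuous_inM cxi' cph) (ct Cu))
  (continuous_inM (continuous_inM cxi cph') (ct Cv))).
Qed.

Let laplacian_continuous w0 w : classical_component Om T w0 w ->
  continuous_in Om T (fun t => laplacian (w t)).
Proof. by move=> Cw; apply: continuous_in_sum => i; exact: c2 Cw. Qed.

Lemma energy_source_continuous : continuous_in Om T energy_source.
Proof.
have cs w0 w e : classical_component Om T w0 w ->
    continuous_in Om T (fun t x => time_derivative w t x - e * laplacian (w t) x).
  move=> Cw; apply: continuous_inB; first exact: ct Cw.
  by apply: continuous_inM; [exact: continuous_in_cst|exact: laplacian_continuous Cw].
exact (continuous_inD (continuous_inM (continuous_inM cxi' cph) (cs _ _ a Cu))
  (continuous_inM (continuous_inM cxi cph') (cs _ _ b Cv))).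
Qed.

Let flux_continuous i : continuous_in Om T (flux i).
Proof.
exact (continuous_inD
  (continuous_inM (@continuous_in_cst R N Om T a) (continuous_inM (continuous_inM cxi' cph) (@c1 _ _ i Cu)))
  (continuous_inM (@continuous_in_cst R N Om T b) (continuous_inM (continuous_inM cxi cph') (@c1 _ _ i Cv)))).
Qed.

Let flux_partial_continuous i : continuous_in Om T (flux_partial i).
Proof.
have cu1 := @c1 _ _ i Cu; have cv1 := @c1 _ _ i Cv.
have cuu := continuous_in_sqr cu1; have cvv := continuous_in_sqr cv1.
have cuv := continuous_inM cu1 cv1.
have k1 := continuous_inM (continuous_inM cxi2 cph) cuu.
have k2 := continuous_inM (continuous_inM cxi' cph') cuv.
have k3 := continuous_inM (continuous_inM cxi' cph) (@c2 _ _ i Cu).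
have k4 := continuous_inM (continuous_inM cxi cph2) cvv.
have k5 := continuous_inM (continuous_inM cxi cph') (@c2 _ _ i Cv).
exact (continuous_inD
  (continuous_inM (@continuous_in_cst R N Om T a) (continuous_inD (continuous_inD k1 k2) k3))
  (continuous_inM (@continuous_in_cst R N Om T b) (continuous_inD (continuous_inD k2 k4) k5))).
Qed.

Lemma energy_density_vanishes : vanishes_below Om T k u energy_density.
Proof. by move=> t x _ /xi_vanish[e _ _]; rewrite /energy_density e mul0r. Qed.

Let energy_density_t_vanishes : vanishes_below Om T k u energy_density_t.
Proof. by move=> t x _ /xi_vanish[e e' _]; rewrite /energy_density_t e e' !mul0r addr0. Qed.

Lemma energy_source_vanishes : vanishes_below Om T k u energy_source.
Proof. by move=> t x _ /xi_vanish[e e' _]; rewrite /energy_source e e' !mul0r addr0. Qed.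

Let flux_vanishes i : vanishes_below Om T k u (flux i).
Proof. by move=> t x _ /xi_vanish[e e' _]; rewrite /flux e e' !mul0r !mulr0 addr0. Qed.

Let flux_partial_vanishes i : vanishes_below Om T k u (flux_partial i).
Proof. by move=> t x _ /xi_vanish[e e' e2]; rewrite /flux_partial e e' e2 !(mul0r, mulr0, addr0). Qed.

Lemma energy_is_derive t : 0 < t -> (t%:E < T)%E ->
  is_derive t 1 energy (integ (ext0 Om (energy_density_t t))).
Proof.
move=> t0 tT; apply: (integral_ext0_is_derive oO Or Cu k0) => //.
- exact: energy_density_vanishes.
- exact: energy_density_continuous.
move=> s x sx; have [/= s0 sT Ox] := sx.
have dt w0 w : classical_component Om T w0 w -> is_derive s 1 (w ^~ x) (time_derivative w s x).
  move=> Cw; rewrite /time_derivative derive1E; apply: derivableP.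
  have [dw _ _ _] := component_C12 Cw s0 sT Ox; exact: dw.
have du := dt _ _ Cu; have dv := dt _ _ Cv.
have d1 := is_derive_comp_dir du (dxi (u s x)).
have d2 := is_derive_comp_dir dv (dph (v_ge0 sx)).
apply: (is_derive_eq (is_deriveM d1 d2)).
rewrite /energy_density_t /GRing.scale/=; ring.
Qed.

Lemma flux_is_derive i t x : spacetime Om T (t, x) ->
  is_derive x (delta_mx 0 i) (flux i t) (flux_partial i t x).
Proof.
move=> tx; have [/= t0 tT Ox] := tx.
have d1 w0 w : classical_component Om T w0 w -> is_derive x (delta_mx 0 i) (w t) (partial i (w t) x).
  by move=> Cw; apply: derivableP; have [_ _ /(_ i)[]] := component_C12 Cw t0 tT Ox.
have d2 w0 w : classical_component Om T w0 w ->
    is_derive x (delta_mx 0 i) (partial i (w t)) (partial i (partial i (w t)) x).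
  by move=> Cw; apply: derivableP; have [_ _ _ /(_ i i)[]] := component_C12 Cw t0 tT Ox.
have du := d1 _ _ Cu; have dv := d1 _ _ Cv; have du2 := d2 _ _ Cu; have dv2 := d2 _ _ Cv.
have e1 := is_derive_comp_dir du (dxi (u t x)).
have e2 := is_derive_comp_dir du (dxi' (u t x)).
have e3 := is_derive_comp_dir dv (dph (v_ge0 tx)).
have e4 := is_derive_comp_dir dv (dph' (v_ge0 tx)).
have h1 := is_deriveZ a (is_deriveM (is_deriveM e2 e3) du2).
have h2 := is_deriveZ b (is_deriveM (is_deriveM e1 e4) dv2).
apply: (is_derive_eq (is_deriveD h1 h2)).
rewrite /flux_partial /GRing.scale/= !fctE.
move: (xi'' (u t x)) (xi' (u t x)) (xi (u t x)) (ph (v t x)) (ph' (v t x)) (ph'' (v t x))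
  (partial i (u t) x) (partial i (v t) x) (partial i (partial i (u t)) x)
  (partial i (partial i (v t)) x) => *; ring.
Qed.

(** An arbitrary list of directions replaces the full sum so that induction applies. *)
Lemma integ_sum_flux t (s : seq 'I_N) : 0 < t -> (t%:E < T)%E ->
  integ (ext0 Om (fun x => \sum_(i <- s) flux_partial i t x)) = 0.
Proof.
move=> t0 tT; elim: s => [|i s IH].
  rewrite [ext0 _ _](_ : _ = cst 0); first by rewrite /integ Rintegral_cst// mul0r.
  by apply/funext => x; rewrite /ext0 big_nil; case: ifP.
rewrite [ext0 _ _](_ : _ = fun x => ext0 Om (flux_partial i t) x +
    ext0 Om (fun x => \sum_(i <- s) flux_partial i t x) x); last first.
  by apply/funext => x; rewrite /ext0 big_cons; case: ifP; rewrite ?addr0.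
rewrite (@integD _ _ r) ?IH ?addr0.
- apply: (@integral_ext0_partial _ _ _ _ oO _ _ _ Cu k0 r (flux i) (flux_partial i) i t) => //.
  by move=> x Ox; exact: flux_is_derive.
- exact: (ext0_continuous_slice oO Cu k0 (@flux_partial_vanishes i) (@flux_partial_continuous i)).
- exact: ext0_vanishes_outside.
- apply: (ext0_continuous_slice oO Cu k0 (W := fun t x => \sum_(i <- s) flux_partial i t x)) => //.
    exact: vanishes_below_sum.
  exact: continuous_in_sum.
- exact: ext0_vanishes_outside.
Qed.

(** Pointwise, source plus divergence of the flux minus [energy_density_t] is the sum over the
    directions of the quadratic form in [(partial i u, partial i v)]. Its mixed coefficient is
    [a + b], one cross term coming from each equation. The divergence integrates to 0. *)
Lemma energy_rate_le t M : 0 < t -> (t%:E < T)%E ->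
  (forall x, Om x -> v t x <= M) ->
  (forall x y p q, 0 <= y <= M -> 0 <= a * (xi'' x * ph y) * p ^+ 2 +
    (a + b) * (xi' x * ph' y) * (p * q) + b * (xi x * ph'' y) * q ^+ 2) ->
  integ (ext0 Om (energy_density_t t)) <= integ (ext0 Om (energy_source t)).
Proof.
move=> t0 tT vM Q; pose F t x := \sum_(i < N) flux_partial i t x.
have cF : continuous_in Om T F by exact: continuous_in_sum.
have vF : vanishes_below Om T k u F by exact: vanishes_below_sum.
have cS := ext0_continuous_slice oO Cu k0 energy_source_vanishes energy_source_continuous t0 tT.
have cFt := ext0_continuous_slice oO Cu k0 vF cF t0 tT.
have cW := ext0_continuous_slice oO Cu k0 energy_density_t_vanishes energy_density_t_continuous t0 tT.
rewrite -[leRHS]addr0 -(integ_sum_flux (index_enum 'I_N) t0 tT).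
rewrite -(@integD _ _ r) //; try exact: ext0_vanishes_outside.
apply: (@le_integ _ _ r) => //; try exact: ext0_vanishes_outside.
- by move=> x; exact (continuousD (cS x) (cFt x)).
- by move=> x rx; rewrite (@ext0_vanishes_outside _ _ _ _ Or (energy_source t) x rx) (@ext0_vanishes_outside _ _ _ _ Or _ x rx) addr0.
move=> x; have [Ox|Ox] := pselect (Om x); last by rewrite !ext0N// addr0.
rewrite !ext0E// -subr_ge0.
have v0M : 0 <= v t x <= M by rewrite vM// v_ge0.
pose G i := a * (xi'' (u t x) * ph (v t x)) * partial i (u t) x ^+ 2 +
    (a + b) * (xi' (u t x) * ph' (v t x)) * (partial i (u t) x * partial i (v t) x) +
    b * (xi (u t x) * ph'' (v t x)) * partial i (v t) x ^+ 2.
have -> : \sum_(i < N) flux_partial i t x = \sum_(i < N) G i +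
    (a * (xi' (u t x) * ph (v t x)) * laplacian (u t) x +
     b * (xi (u t x) * ph' (v t x)) * laplacian (v t) x).
  rewrite /laplacian !mulr_sumr -!big_split/=; apply: eq_bigr => i _.
  rewrite /flux_partial /G.
  move: (xi'' (u t x)) (xi' (u t x)) (xi (u t x)) (ph (v t x)) (ph' (v t x)) (ph'' (v t x))
    (partial i (u t) x) (partial i (v t) x) (partial i (partial i (u t)) x)
    (partial i (partial i (v t)) x) => *; ring.
rewrite [leRHS](_ : _ = \sum_(i < N) G i); first by apply: sumr_ge0 => i _; exact: Q.
rewrite /energy_source /energy_density_t.
move: (xi' (u t x)) (xi (u t x)) (ph (v t x)) (ph' (v t x)) (time_derivative u t x)
  (time_derivative v t x) (laplacian (u t) x) (laplacian (v t) x) (\sum_(i < N) G i) => *; ring.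
Qed.

End energy.

(** * The slope of the weight and the sign of the reaction factor *)

Section weight.
Context {R : realType}.

Section profile.
Variables (eta v : R).
Hypotheses (eta0 : 0 < eta) (v0 : 0 <= v).

(** Derivative of [x^2 / (x + eta)], that is [1 - eta^2 / (v + eta)^2]: a concave function with
    slope [2 / eta] at 0, saturating at 1. *)
Definition profile : R := v * (v + 2 * eta) / (v + eta) ^+ 2.

Let ve0 : 0 < (v + eta) ^+ 2.
Proof. by rewrite exprn_gt0// ltr_wpDl. Qed.

Lemma profile_ge0 : 0 <= profile.
Proof. by rewrite divr_ge0 ?(ltW ve0)// mulr_ge0// addr_ge0// mulr_ge0// ltW. Qed.

Lemma profile_le1 : profile <= 1.
Proof. by rewrite ler_pdivrMr// mul1r; have := sqr_ge0 eta; nra. Qed.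

Lemma profile_le_linear : profile <= 2 * v / eta.
Proof.
rewrite ler_pdivrMr// mulrAC ler_pdivlMr//.
rewrite -!mulrA [leRHS]mulrCA ler_wpM2l//; have := sqr_ge0 v; have := mulr_ge0 (ltW eta0) v0; nra.
Qed.

Lemma profile_ge_half : eta <= v -> 1 / 2 <= profile.
Proof.
move=> ev; rewrite ler_pdivlMr//.
have h : eta * eta <= eta * v by rewrite ler_pM2l.
have := mulr_ge0 (ltW eta0) v0; have := sqr_ge0 v; lra.
Qed.

(** The chord of a concave function between 0 and [eta], where its value is 3/4. *)
Lemma profile_ge_linear : v <= eta -> 3 / 4 * v / eta <= profile.
Proof.
move=> vle; rewrite ler_pdivrMr// /profile [leRHS]mulrAC ler_pdivlMr//.
rewrite [leLHS](_ : _ = v * (3 / 4 * (v + eta) ^+ 2)); last by ring.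
rewrite -!mulrA ler_wpM2l//.
have h1 : v * v <= eta * eta by rewrite ler_pM.
have h2 : v * eta <= eta * eta by rewrite ler_pM2r.
lra.
Qed.

(** The right-hand side dominates its second-order Taylor polynomial at 0, [2 x - 3 x^2] with
    [x = v / eta]. *)
Lemma profile_ge_quadratic :
  2 * v / eta * (1 - 3 * v / (2 * eta)) <= profile.
Proof.
rewrite ler_pdivlMr//.
rewrite [leLHS](_ : _ = v * ((2 * eta - 3 * v) * (v + eta) ^+ 2 / eta ^+ 2)); last first.
  by field; rewrite gt_eqF.
rewrite ler_wpM2l// ler_pdivrMr ?exprn_gt0//.
rewrite -subr_ge0 (_ : _ - _ = 4 * eta * v ^+ 2 + 3 * v ^+ 3); last by ring.
by rewrite addr_ge0// mulr_ge0 ?exprn_ge0// mulr_ge0// ltW.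
Qed.

End profile.

(* The sign condition behind the energy estimate: with [eta = 2 A be / P], the
   weight behaves like [ph' v = P v / be] for small [v], so both factors change
   sign at [u v = be], up to errors absorbed by [P / 4]. *)
Lemma weight_sign (A B be P eta u v f : R) :
  0 < A -> 0 <= B -> 0 < be -> 0 < P -> eta = 2 * A * be / P ->
  2 * B * be ^+ 2 <= P / 4 ->
  0 <= v -> 1 <= f -> f <= 5 / 4 -> f <= 1 + 2 * A * v ->
  6 <= u -> 1 + 4 * P / A <= u -> 12 * be * (8 * A * be + 4 + 24 * be / eta) <= u ->
  (u * v - be) * (P * f - (u - 1) * (A * profile eta v + 2 * B * v)) <= P / 4.
Proof.
move=> A0 B0 be0 P0 etaE Bbe v0 f1 f54 fv u6 uA ube.
have eta0 : 0 < eta by rewrite etaE divr_gt0// !mulr_gt0.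
have u0 : 0 < u by lra.
have g0 := profile_ge0 eta0 v0.
set g := profile eta v in g0 *; set s := u * v.
have s0 : 0 <= s by rewrite mulr_ge0// ltW.
have Bv0 : 0 <= 2 * B * v by rewrite !mulr_ge0.
have Pf : P <= P * f by rewrite ler_peMr// ltW.
have Pf54 : P * f <= 5 / 4 * P by rewrite mulrC ler_pM2r.
(* This identity is the reason for the choice of [eta]. *)
have slope : A * (2 * v / eta) * u = P * s / be.
  by rewrite /s etaE; field; rewrite !gt_eqF.
(* Below the critical value, the linear upper bound on [profile] leaves [- P / be (be - s)^2] plus
   an error from [B] of at most [2 B be^2]. *)
have [sbe|bes] := ltP s be.
  have gs : A * g * u <= P * s / be.
    by rewrite -slope ler_pM2r// ler_pM2l//; exact: profile_le_linear.
  have fs : (u - 1) * (A * g + 2 * B * v) <= P * s / be + 2 * B * s.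
    have : 0 <= A * g + 2 * B * v by rewrite addr_ge0// mulr_ge0// ltW.
    rewrite /s in gs *; lra.
  apply: (@le_trans _ _ ((be - s) * (P * s / be + 2 * B * s - P))).
    by rewrite -opprB mulNr -mulrN ler_pM2l ?subr_gt0//; lra.
  have -> : P * s / be + 2 * B * s - P = 2 * B * s - P / be * (be - s).
    by field; rewrite gt_eqF.
  have h1 : 0 <= P / be * (be - s) ^+ 2 by rewrite mulr_ge0 ?sqr_ge0// divr_ge0// ltW.
  have h2 : 2 * B * (s * (be - s)) <= 2 * B * be ^+ 2.
    by rewrite ler_wpM2l ?mulr_ge0//; nra.
  nra.
have s_be : 0 <= s - be by rewrite subr_ge0.
have u1 : 0 <= u - 1 by lra.
have suff0 x : P * f <= (u - 1) * (A * g) -> x = 2 * B * v -> (s - be) * (P * f - (u - 1) * (A * g + x)) <= P / 4.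
  move=> h ->; apply: (@le_trans _ _ 0); last by rewrite divr_ge0// ltW.
  by rewrite mulr_ge0_le0// subr_le0 (le_trans h)// ler_wpM2l// lerDl.
(* For [v >= eta] the slope is at least [A / 2], so [1 + 4 P / A <= u] makes the second factor
   nonpositive. *)
have [vlt|ev] := ltP v eta; last first.
  apply: suff0 => //; have g12 := profile_ge_half eta0 v0 ev.
  have : 4 * P <= (u - 1) * A by rewrite -ler_pdivrMr//; lra.
  rewrite -/g in g12; have uA0 : 0 <= (u - 1) * A by rewrite mulr_ge0// ltW.
  have : (u - 1) * A * (1 / 2) <= (u - 1) * A * g by rewrite ler_wpM2l.
  lra.
(* Here [A g u >= (3 / 8) 4 P = 3 P / 2], and [u - 1 >= 5 u / 6] turns this into [5 P / 4], the
   upper bound of [P f]. *)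
have [s4|s4] := leP (4 * be) s.
  apply: suff0 => //; have g34 := profile_ge_linear eta0 v0 (ltW vlt).
  rewrite -/g in g34.
  have h : 3 / 8 * (P * s / be) <= A * g * u.
    rewrite -slope (_ : 3 / 8 * _ = A * (3 / 4 * v / eta) * u); last by field; rewrite gt_eqF.
    by rewrite ler_pM2r// ler_pM2l.
  have h' : 4 * P <= P * s / be by rewrite ler_pdivlMr//; nra.
  have : A * g * u <= (6 / 5) * ((u - 1) * (A * g)).
    have : 0 <= A * g by rewrite mulr_ge0// ltW.
    nra.
  lra.
(* In the remaining window [be <= s < 4 be] the second factor may be positive, but [v] is of order
   [1 / u], hence so is that factor: at most [P / (12 be)], against a first factor below [3 be]. *)
have gq := profile_ge_quadratic eta0 v0; rewrite -/g in gq.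
have vu : v <= 4 * be / u by rewrite ler_pdivlMr// mulrC ltW.
(* Relative errors made by replacing [u - 1] with [u] and [profile] with its tangent at 0. *)
pose E := 1 / u + 3 * v / (2 * eta).
have Ele : P * s / be - 4 * P * E <= (u - 1) * (A * g).
  have h1 : P * s / be * (1 - 3 * v / (2 * eta)) <= A * g * u.
    rewrite -slope [leLHS](_ : _ = A * (2 * v / eta * (1 - 3 * v / (2 * eta))) * u).
      by rewrite ler_pM2r// ler_pM2l.
    by ring.
  have h2 : A * g <= P * s / be / u.
    rewrite -slope mulfK ?gt_eqF// ler_pM2l//; exact: profile_le_linear.
  have h3 : P * s / be <= 4 * P by rewrite ler_pdivrMr//; nra.
  have v2 : 0 <= 3 * v / (2 * eta) by rewrite divr_ge0 ?mulr_ge0// ltW.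
  have h4 : P * s / be * (1 / u + 3 * v / (2 * eta)) <= 4 * P * E.
    by rewrite ler_wpM2r// addr_ge0// divr_ge0// ltW.
  move: h4; rewrite mulrDr mul1r; move: h1; rewrite mulrBr mulr1; lra.
have h5 : P * f - (u - 1) * (A * g + 2 * B * v) <= 2 * A * P * v + 4 * P * E.
  have : P * f <= P + 2 * A * P * v.
    by rewrite (le_trans (ler_wpM2l (ltW P0) fv))//; lra.
  have : P <= P * s / be by rewrite ler_pdivlMr// ler_pM2l.
  have : 0 <= (u - 1) * (2 * B * v) by rewrite mulr_ge0.
  lra.
have h6 : 2 * A * P * v + 4 * P * E <= P * (8 * A * be + 4 + 24 * be / eta) / u.
  have -> : P * (8 * A * be + 4 + 24 * be / eta) / u =
      2 * A * P * (4 * be / u) + 4 * P * (1 / u + 3 * (4 * be / u) / (2 * eta)).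
    by field; rewrite !gt_eqF.
  rewrite lerD ?ler_wpM2l ?mulr_ge0 ?(ltW A0) ?(ltW P0)// /E lerD2l.
  by rewrite ler_pM2r ?invr_gt0 ?mulr_gt0// ler_pM2l.
set K := 8 * A * be + 4 + 24 * be / eta in ube h6.
have K0 : 0 <= K by rewrite !addr_ge0// ?divr_ge0 ?mulr_ge0// ltW.
have h7 : P * K / u <= P / (12 * be).
  rewrite ler_pdivrMr// mulrAC ler_pdivlMr ?mulr_gt0//; nra.
apply: (le_trans (ler_wpM2l s_be (le_trans h5 (le_trans h6 h7)))).
rewrite (_ : P / 4 = 3 * be * (P / (12 * be))); last by field; rewrite gt_eqF.
rewrite ler_wpM2r ?divr_ge0 ?mulr_ge0 ?(ltW P0) ?(ltW be0)//; lra.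
Qed.

End weight.

(** * Choice of the parameters of the weight *)

Section weight_existence.
Context {R : realType}.

Lemma profile_is_derive (eta v : R) : 0 < eta -> 0 <= v ->
  is_derive v 1 (profile eta) (2 * eta ^+ 2 / (v + eta) ^+ 3).
Proof.
move=> eta0 v0; have ve : v + eta != 0 by rewrite gt_eqF// ltr_wpDl.
have ve2 : (v + eta) ^+ 2 != 0 by rewrite expf_neq0.
have d1 : is_derive v 1 (fun x => (x + eta) ^+ 2) (2 * (v + eta)).
  by apply: is_derive_eq; rewrite /GRing.scale/=; ring.
have d2 := @is_deriveV R (fun x => (x + eta) ^+ 2) v _ 1 ve2 d1.
have d3 : is_derive v 1 (fun x => x * (x + 2 * eta)) (2 * v + 2 * eta).
  by apply: is_derive_eq; rewrite /GRing.scale/=; ring.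
apply: (is_derive_eq (is_deriveM d3 d2)).
by rewrite /GRing.scale/=; field; rewrite ve.
Qed.

Lemma profile_primitive (eta v : R) : 0 < eta -> 0 <= v ->
  is_derive v 1 (fun x => x ^+ 2 / (x + eta)) (profile eta v).
Proof.
move=> eta0 v0; have ve : v + eta != 0 by rewrite gt_eqF// ltr_wpDl.
have d1 : is_derive v 1 (fun x => x + eta) 1.
  by apply: is_derive_eq; rewrite addr0.
have d2 := @is_deriveV R (fun x => x + eta) v _ 1 ve d1.
have d3 : is_derive v 1 (fun x : R => x ^+ 2) (2 * v).
  by apply: is_derive_eq; rewrite /GRing.scale/=; ring.
apply: (is_derive_eq (is_deriveM d3 d2)).
by rewrite /profile /GRing.scale/=; field; rewrite ve.
Qed.

Lemma weight_exists (kap M be P eps : R) :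
  0 < kap -> 0 < M -> 0 < be -> 0 < P -> 0 < eps -> eps <= 1 / 4 ->
  exists U : R, exists ph : R -> R, exists ph' : R -> R, exists ph'' : R -> R,
  [/\ forall v : R, 0 <= v ->
        [/\ is_derive v 1 ph (ph' v), is_derive v 1 ph' (ph'' v) & {for v, continuous ph''}],
      forall v, 0 <= v <= M -> [/\ 1 <= ph v, ph v <= 1 + eps, 0 <= ph' v, ph' v <= eps
        & kap * ph' v ^+ 2 <= ph'' v] &
      forall u v, U <= u -> 0 <= v <= M ->
        (u * v - be) * (P * ph v - (u - 1) * ph' v) <= P / 4].
Proof.
move=> kap0 M0 be0 P0 eps0 eps4.
(* [A] is the only free parameter. Every constraint bounds it from above, so the inverse of the sum
   of all requirements serves. *)
have [A [A0 A1 [Aeps AepsM AkM Abe]]] : exists A : R, [/\ 0 < A, A <= 1 &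
    [/\ 2 * A <= eps, 2 * A * M <= eps, 4 * kap * A * M <= 1 & 16 * kap * A * be ^+ 2 <= P]].
  pose D := 1 + 2 / eps + 2 * M / eps + 4 * kap * M + 16 * kap * be ^+ 2 / P.
  have p1 : 0 < 2 / eps by rewrite divr_gt0.
  have p2 : 0 < 2 * M / eps by rewrite divr_gt0 ?mulr_gt0.
  have p3 : 0 < 4 * kap * M by rewrite !mulr_gt0.
  have p4 : 0 < 16 * kap * be ^+ 2 / P by rewrite divr_gt0 ?mulr_gt0 ?exprn_gt0.
  have D0 : 0 < D by rewrite /D; lra.
  exists D^-1; split; [by rewrite invr_gt0|by rewrite invf_le1// /D; lra|].
  have key x y : 0 < y -> x / y <= D -> x * D^-1 <= y.
    by move=> y0 h; rewrite ler_pdivrMr// mulrC -ler_pdivrMr.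
  split.
  - by apply: key => //; rewrite /D; lra.
  - by rewrite mulrAC; apply: key => //; rewrite /D; lra.
  - by rewrite mulrAC; apply: key => //; rewrite divr1 /D; lra.
  - by rewrite mulrAC; apply: key => //; rewrite /D; lra.
(* Since [ph' <= 2 A] on [[0, M]], the constant part [2 B = kap (2 A)^2] of [ph''] alone gives
   [kap ph'^2 <= ph'']. *)
pose B := 2 * kap * A ^+ 2; pose eta := 2 * A * be / P.
have eta0 : 0 < eta by rewrite divr_gt0 ?mulr_gt0.
have B0 : 0 < B by rewrite !mulr_gt0.
have BM : 2 * B * M <= A.
  have -> : 2 * B * M = A * (4 * kap * A * M) by rewrite /B; ring.
  by rewrite ger_pMr.
exists (6 + (1 + 4 * P / A) + 12 * be * (8 * A * be + 4 + 24 * be / eta)).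
exists (fun v => 1 + (A * (v ^+ 2 / (v + eta)) + B * v ^+ 2)).
exists (fun v => A * profile eta v + 2 * B * v).
exists (fun v => A * (2 * eta ^+ 2 / (v + eta) ^+ 3) + 2 * B).
have bound v : 0 <= v <= M -> [/\ v ^+ 2 / (v + eta) <= v, 0 <= v ^+ 2 / (v + eta),
    0 <= B * v ^+ 2 & B * v ^+ 2 <= A * v / 2].
  move=> /andP[v0 vM]; have ve : 0 < v + eta by rewrite ltr_wpDl.
  split.
  - by rewrite ler_pdivrMr// expr2 ler_wpM2l// lerDl ltW.
  - by rewrite divr_ge0 ?sqr_ge0// ltW.
  - by rewrite mulr_ge0 ?sqr_ge0// ltW.
  - have : B * v * v <= B * v * M by rewrite ler_wpM2l// mulr_ge0// ltW.
    have : (2 * B * M) * v <= A * v by rewrite ler_wpM2r.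
    rewrite expr2; lra.
split.
- move=> v v0; have ve : v + eta != 0 by rewrite gt_eqF// ltr_wpDl.
  have d1 := profile_primitive eta0 v0; have d2 := profile_is_derive eta0 v0.
  split.
  + have d3 : is_derive v 1 (fun x : R => x ^+ 2) (2 * v).
      by apply: is_derive_eq; rewrite /GRing.scale/=; ring.
    apply: is_derive_eq.
    by rewrite /GRing.scale/=; ring.
  + apply: is_derive_eq.
    by rewrite /GRing.scale/=; ring.
  + apply: cvgD; last exact: cvg_cst.
    apply: cvgM; first exact: cvg_cst.
    apply: cvgM; first exact: cvg_cst.
    apply: cvgV; first by rewrite expf_neq0.
    apply: (@continuous_comp _ _ _ (fun x => x + eta) (fun y => y ^+ 3)); last exact: exprn_continuous.
    by apply: cvgD; [exact: cvg_id|exact: cvg_cst].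
- move=> v vM; have [b1 b2 b3 b4] := bound v vM; case/andP: vM => v0 vM.
  have g0 := profile_ge0 eta0 v0; have g1 := profile_le1 eta0 v0.
  have h1 : A * (v ^+ 2 / (v + eta)) <= A * v by rewrite ler_pM2l.
  have h2 : 0 <= A * (v ^+ 2 / (v + eta)) by rewrite mulr_ge0// ltW.
  have h3 : A * v <= A * M by rewrite ler_pM2l.
  have h4 : 0 <= 2 * B * v by rewrite !mulr_ge0// ltW.
  have h5 : 2 * B * v <= A by apply: le_trans BM; rewrite ler_pM2l ?mulr_gt0.
  have h6 : 0 <= A * profile eta v by rewrite mulr_ge0// ltW.
  have h7 : A * profile eta v <= A by rewrite ger_pMr.
  split; try lra.
  set f := _ + 2 * B * v.
  have f0 : 0 <= f by rewrite addr_ge0.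
  have f2 : f <= 2 * A by rewrite /f; lra.
  have : kap * f ^+ 2 <= kap * (2 * A) ^+ 2 by rewrite ler_pM2l// lerXn2r// ?nnegrE// (le_trans f0).
  have : 0 <= A * (2 * eta ^+ 2 / (v + eta) ^+ 3).
    apply: mulr_ge0; first exact: ltW.
    apply: divr_ge0; first by rewrite mulr_ge0// sqr_ge0.
    by rewrite exprn_ge0// addr_ge0// ltW.
  rewrite /B; lra.
- move=> u v Uu vM; have [b1 b2 b3 b4] := bound v vM; case/andP: vM => v0 vM.
  have h1 : A * (v ^+ 2 / (v + eta)) <= A * v by rewrite ler_pM2l.
  have h2 : 0 <= A * (v ^+ 2 / (v + eta)) by rewrite mulr_ge0// ltW.
  have h3 : A * v <= A * M by rewrite ler_pM2l.
  have p1 : 0 < P / A by rewrite divr_gt0.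
  have p2 : 0 < 12 * be * (8 * A * be + 4 + 24 * be / eta).
    have : 0 < 24 * be / eta by rewrite divr_gt0// mulr_gt0.
    have : 0 < 8 * A * be by rewrite mulr_gt0// mulr_gt0.
    by move=> ? ?; apply: mulr_gt0; [exact: mulr_gt0|lra].
  apply: weight_sign => //; try lra.
  have : 16 * kap * A * be ^+ 2 * A <= P by rewrite (le_trans _ Abe)// ger_pMr// !mulr_gt0// exprn_gt0.
  rewrite /B; lra.
Qed.

End weight_existence.

(** * Powers of the positive part of [x - 1] *)

Section truncated_power.
Context {R : realType}.

Definition trunc_pow (m : nat) (x : R) : R := Num.max (x - 1) 0 ^+ m.

Lemma trunc_pow_ge0 m x : 0 <= trunc_pow m x.
Proof. by rewrite exprn_ge0// le_max lexx orbT. Qed.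

Lemma trunc_pow_eq0 m x : x <= 1 -> trunc_pow m.+1 x = 0.
Proof. by move=> x1; rewrite /trunc_pow max_r ?subr_le0// expr0n. Qed.

Lemma trunc_powE m x : 1 <= x -> trunc_pow m x = (x - 1) ^+ m.
Proof. by move=> x1; rewrite /trunc_pow max_l// subr_ge0. Qed.

(** Serves at the junction point 1, where a truncated power of exponent at least 2 is quadratically
    small. *)
Lemma is_derive_quadratic_bound (f : R -> R) (x : R) :
  f x = 0 -> (forall h, `|h| < 1 -> `|f (h + x)| <= h ^+ 2) -> is_derive x 1 f 0.
Proof.
move=> fx fb.
have H : (fun h : R => h^-1 *: (f (h *: 1 + x) - f x)) @ 0^' --> (0 : R).
  apply/cvgrPdist_lt => e e0; near=> h.
  rewrite fx subr0 sub0r normrN [h *: 1]mulr1 normrM normfV.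
  have h0 : h != 0 by near: h; exact: nbhs_dnbhs_neq.
  have h1 : `|h| < 1.
    by near: h; apply: dnbhs0_lt.
  rewrite mulrC ltr_pdivrMr ?normr_gt0//.
  apply: (le_lt_trans (fb _ h1)); rewrite -(real_normK (num_real h)) expr2.
  by rewrite ltr_pM2r ?normr_gt0//; near: h; apply: dnbhs0_lt.
by apply: DeriveDef; [apply/cvg_ex; exists 0|exact/cvg_lim].
Unshelve. all: end_near. Qed.

Lemma trunc_pow_is_derive m (x : R) :
  is_derive x 1 (trunc_pow m.+2) (m.+2%:R * trunc_pow m.+1 x).
Proof.
have [x1|x1|->] := ltgtP x 1.
- rewrite trunc_pow_eq0 ?ltW// mulr0.
  apply: (@near_eq_is_derive _ _ _ (cst 0)).
  near=> y; rewrite trunc_pow_eq0//; apply: ltW; near: y; exact: lt_nbhsl.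
- rewrite trunc_powE ?ltW//.
  apply: (@near_eq_is_derive R R R (fun y : R => (y - 1) ^+ m.+2)).
    by near=> y; rewrite trunc_powE//; apply: ltW; near: y; exact: lt_nbhsr.
  have d1 : is_derive x 1 (fun y : R => y - 1) 1.
    by apply: is_derive_eq; rewrite subr0.
  have -> : (fun y : R => (y - 1) ^+ m.+2) = (fun y : R => y - 1) ^+ m.+2.
    by apply/funext => y; rewrite exprfctE.
  by apply: (is_derive_eq (is_deriveX m.+2 d1)); rewrite [LHS]mulr1.
- rewrite trunc_pow_eq0// mulr0; apply: is_derive_quadratic_bound.
    by rewrite trunc_pow_eq0.
  move=> h h1; have [h0|h0] := leP h 0.
    by rewrite trunc_pow_eq0 ?normr0 ?sqr_ge0// gerDr.
  rewrite trunc_powE; last by rewrite lerDr ltW.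
  rewrite addrK normrX gtr0_norm// -[m.+2]addn2 exprD.
  by rewrite gtr0_norm// in h1; rewrite ger_pMl ?exprn_gt0// exprn_ile1// ltW.
Unshelve. all: end_near. Qed.

End truncated_power.

(** * Reaction terms of a single pair *)

Section dissipation.
Context {R : realType}.

Variables (m : nat) (P al be M eps U : R) (ph ph' : R -> R).
Local Notation X := (@trunc_pow R m.+1).
Local Notation Y := (@trunc_pow R m).

Lemma trunc_pow_mul x : X x = Num.max (x - 1) 0 * Y x.
Proof. by rewrite /trunc_pow exprS. Qed.

Hypothesis weight_bounds : forall v : R, 0 <= v <= M ->
  [/\ 1 <= ph v, ph v <= 1 + eps, 0 <= ph' v & ph' v <= eps].
Hypothesis weight_sign_bound : forall u v : R, U <= u -> 0 <= v <= M ->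
  (u * v - be) * (P * ph v - (u - 1) * ph' v) <= P / 4.

(* The coupling [D1 (w - u)] is left out: it needs the energies of both pairs. *)
Definition reaction (D u v z : R) : R :=
  P * Y u * ph v * (al - (be + 1) * u + u ^+ 2 * v)
  + X u * ph' v * (be * u - u ^+ 2 * v + D * (z - v)).

(** Below a threshold [V] everything is bounded and goes into [C]. Above it, [X u = (u - 1) Y u]
    turns the [u^2 v] terms and the [be u] terms into [u] times the product controlled by
    [weight_sign_bound]. *)
Lemma reaction_le (D : R) : 0 < P -> 0 < al -> 0 < be -> 0 < M -> eps <= 1 / 4 -> 0 < D -> D * M * eps <= P / 8 ->
  exists C : R, forall u v z : R, 0 <= u -> 0 <= v <= M -> 0 <= z <= M ->
    reaction D u v z <= C - 3 / 8 * P * X u.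
Proof.
move=> P0 al0 be0 M0 eps1 D0 DM; pose V := Num.max (Num.max U (8 * al)) 1.
have V1 : 1 <= V by rewrite le_max lexx orbT.
have VU u : V < u -> U <= u /\ 8 * al <= u.
  by move/ltW; rewrite !ge_max => /andP[/andP[]].
move: V V1 VU => V V1 VU.
pose C := P * V ^+ m * 2 * (al + V ^+ 2 * M) + V ^+ m.+1 * (be * V + D * M) + P * V ^+ m.+1.
exists C => u v z u0 vM zM; have [f1 f2 f3 f4] := weight_bounds vM.
have [v0 vM'] := andP vM; have [z0 zM'] := andP zM.
have Y0 : 0 <= Y u by exact: trunc_pow_ge0.
have X0 : 0 <= X u by exact: trunc_pow_ge0.
have V0 : 0 < V by exact: lt_le_trans V1.
have ph0 : 0 <= ph v by lra.
have PY0 : 0 <= P * Y u by apply: mulr_ge0 => //; exact: ltW.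
have [uV|Vu] := leP u V.
  have pu : 0 <= Num.max (u - 1) 0 <= V.
    by rewrite le_max lexx orbT/= ge_max (ltW V0) andbT; lra.
  have powV n : trunc_pow n u <= V ^+ n.
    by case/andP: pu => pu0 puV; apply: lerXn2r; rewrite // nnegrE ltW.
  have YV : Y u <= V ^+ m by exact: powV.
  have XV : X u <= V ^+ m.+1 by exact: powV.
  have u2 : u ^+ 2 * v <= V ^+ 2 * M.
    apply: ler_pM => //; first exact: sqr_ge0.
    by apply: lerXn2r; rewrite // nnegrE ltW.
  have u2v : 0 <= u ^+ 2 * v by rewrite mulr_ge0// sqr_ge0.
  have h1 : P * Y u * ph v * (al - (be + 1) * u + u ^+ 2 * v) <=
      P * V ^+ m * 2 * (al + V ^+ 2 * M).
    apply: (@le_trans _ _ (P * Y u * ph v * (al + V ^+ 2 * M))).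
      apply: ler_wpM2l; first exact: mulr_ge0.
      have : 0 <= (be + 1) * u by rewrite mulr_ge0//; lra.
      lra.
    apply: ler_wpM2r; first by apply: addr_ge0; [exact: ltW|exact: le_trans u2].
    apply: ler_pM => //; last lra.
    by rewrite ler_pM2l.
  have h2 : X u * ph' v * (be * u - u ^+ 2 * v + D * (z - v)) <= V ^+ m.+1 * (be * V + D * M).
    apply: (@le_trans _ _ (X u * ph' v * (be * V + D * M))).
      apply: ler_wpM2l; first by rewrite mulr_ge0.
      have : be * u <= be * V by rewrite ler_pM2l.
      have : D * (z - v) <= D * M by rewrite ler_pM2l//; lra.
      lra.
    apply: ler_wpM2r; first by rewrite addr_ge0// mulr_ge0// ltW.
    have : X u * ph' v <= X u * 1 by rewrite ler_wpM2l//; lra.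
    lra.
  have h3 : 3 / 8 * P * X u <= P * V ^+ m.+1.
    have : P * X u <= P * V ^+ m.+1 by rewrite ler_pM2l.
    have : 0 <= P * X u by rewrite mulr_ge0// ltW.
    lra.
  rewrite /reaction /C; lra.
have u1 : 1 < u by exact: le_lt_trans Vu.
have XY : X u = (u - 1) * Y u by rewrite trunc_pow_mul max_l// subr_ge0 ltW.
have [Uu al8] := VU _ Vu.
have ws := weight_sign_bound Uu vM.
have C0 : 0 <= C.
  rewrite /C !addr_ge0 ?mulr_ge0 ?addr_ge0 ?mulr_ge0 ?exprn_ge0 ?(ltW V0) ?(ltW P0) ?(ltW al0) ?(ltW be0) ?(ltW D0) ?(ltW M0)//.
have -> : reaction D u v z = Y u * (P * ph v * al - P * ph v * u
    + u * ((u * v - be) * (P * ph v - (u - 1) * ph' v)) + (u - 1) * (ph' v * D * (z - v))).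
  by rewrite /reaction XY; ring.
(* Out of the damping [P u], the source [al] and the sign condition take a quarter each and the
   exchange [D (z - v)] an eighth. *)
apply: (@le_trans _ _ (Y u * (- (3 / 8 * P * u)))).
  apply: ler_wpM2l => //.
  have a1 : P * ph v * al <= P * u / 4.
    have : P * ph v * al <= P * 2 * al by rewrite ler_pM2r// ler_pM2l//; lra.
    have : P * (8 * al) <= P * u by rewrite ler_pM2l.
    lra.
  have a2 : P * u <= P * ph v * u by rewrite ler_pM2r ?ler_peMr ?(ltW P0)//; lra.
  have a3 : u * ((u * v - be) * (P * ph v - (u - 1) * ph' v)) <= u * (P / 4) by rewrite ler_pM2l//; lra.
  have a4 : (u - 1) * (ph' v * D * (z - v)) <= u * (P / 8).
    apply: (@le_trans _ _ ((u - 1) * (P / 8))); last by rewrite ler_pM2r ?divr_gt0//; lra.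
    apply: ler_wpM2l; first by lra.
    have : ph' v * D * (z - v) <= ph' v * D * M by rewrite ler_wpM2l ?mulr_ge0 ?(ltW D0)//; lra.
    have : ph' v * (D * M) <= eps * (D * M) by rewrite ler_wpM2r// mulr_ge0// ltW.
    lra.
  lra.
have : P * ((u - 1) * Y u) <= P * (u * Y u) by rewrite ler_pM2l// ler_wpM2r//; lra.
rewrite XY; lra.
Qed.

End dissipation.

(** * Exchange between the pairs, and tools for the final estimate *)

Section coupling.
Context {R : realType}.

(** For [f = g = 1] the left side is nonpositive by monotonicity of the truncated power; the
    deviation of the weights from 1 costs only a factor [eps]. Swapping the pairs reduces the proof
    to [u <= w]. *)
Lemma coupling_le (m : nat) (eps f g u w : R) :
  0 <= eps -> 1 <= f <= 1 + eps -> 1 <= g <= 1 + eps ->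
  (w - u) * (trunc_pow m.+1 u * f - trunc_pow m.+1 w * g)
    <= eps * (trunc_pow m.+2 u + trunc_pow m.+2 w).
Proof.
move=> e0.
have ordered f' g' u' w' : 1 <= f' <= 1 + eps -> 1 <= g' <= 1 + eps -> u' <= w' ->
    (w' - u') * (trunc_pow m.+1 u' * f' - trunc_pow m.+1 w' * g') <= eps * trunc_pow m.+2 w'.
  move=> /andP[f1 f2] /andP[g1 g2] uw.
  have Yw := trunc_pow_ge0 m.+1 w'; have Xw := trunc_pow_ge0 m.+2 w'.
  have [u1|u1] := leP u' 1.
    rewrite trunc_pow_eq0// mul0r sub0r mulrN (@le_trans _ _ 0)//; last exact: mulr_ge0.
    by rewrite oppr_le0 mulr_ge0 ?subr_ge0// mulr_ge0// (le_trans ler01).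
  have w1 : 1 < w' by exact: lt_le_trans uw.
  rewrite (trunc_pow_mul m.+1 w') max_l; last by rewrite subr_ge0 ltW.
  have Yuw : trunc_pow m.+1 u' <= trunc_pow m.+1 w'.
    by rewrite !trunc_powE ?(ltW u1) ?(ltW w1)//; apply: lerXn2r; rewrite ?nnegrE; lra.
  have Yu := trunc_pow_ge0 m.+1 u'.
  move: (trunc_pow m.+1 u') (trunc_pow m.+1 w') Yuw Yu Yw => yu yw Yuw Yu Yw.
  have h : yu * f' - yw * g' <= eps * yw.
    have : yu * f' <= yu * (1 + eps) by rewrite ler_wpM2l.
    have : yw * 1 <= yw * g' by rewrite ler_wpM2l.
    have : eps * yu <= eps * yw by rewrite ler_wpM2l.
    lra.
  apply: (@le_trans _ _ ((w' - u') * (eps * yw))); first by rewrite ler_wpM2l// subr_ge0.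
  have : (w' - u') * (eps * yw) <= (w' - 1) * (eps * yw).
    by apply: ler_wpM2r; [exact: mulr_ge0|lra].
  lra.
move=> f1 g1; have Xu := trunc_pow_ge0 m.+2 u; have Xw := trunc_pow_ge0 m.+2 w.
have eXu := mulr_ge0 e0 Xu; have eXw := mulr_ge0 e0 Xw.
have [uw|wu] := leP u w; first by have := ordered f g u w f1 g1 uw; lra.
by have := ordered g f w u g1 f1 (ltW wu); lra.
Qed.

(** The factors [D3] and [D1] give both exchange terms the coefficient [D1 D3 P]. Of the rate
    [3 P / 8] from [reaction_le], the coupling uses [P / 8]; the remaining [P / 4] becomes [P / 8]
    once the weights, at most 2, are put back. *)
Lemma dissipation (m : nat) (P al be M eps U1 U2 D1 D2 D3 D4 : R) (ph1 ph1' ph2 ph2' : R -> R) :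
  0 < P -> 0 < al -> 0 < be -> 0 < M -> 0 < eps -> eps <= 1 / 4 ->
  0 < D1 -> 0 < D2 -> 0 < D3 -> 0 < D4 ->
  D1 * eps <= 1 / 8 -> D3 * eps <= 1 / 8 -> D2 * M * eps <= P / 8 -> D4 * M * eps <= P / 8 ->
  (forall v, 0 <= v <= M -> [/\ 1 <= ph1 v, ph1 v <= 1 + eps, 0 <= ph1' v & ph1' v <= eps]) ->
  (forall v, 0 <= v <= M -> [/\ 1 <= ph2 v, ph2 v <= 1 + eps, 0 <= ph2' v & ph2' v <= eps]) ->
  (forall u v, U1 <= u -> 0 <= v <= M -> (u * v - be) * (P * ph1 v - (u - 1) * ph1' v) <= P / 4) ->
  (forall u v, U2 <= u -> 0 <= v <= M -> (u * v - be) * (P * ph2 v - (u - 1) * ph2' v) <= P / 4) ->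
  exists2 C : R, 0 <= C & forall u v w z : R, 0 <= u -> 0 <= v <= M -> 0 <= w -> 0 <= z <= M ->
    D3 * (P * trunc_pow m.+1 u * ph1 v * (al - (be + 1) * u + u ^+ 2 * v + D1 * (w - u))
          + trunc_pow m.+2 u * ph1' v * (be * u - u ^+ 2 * v + D2 * (z - v)))
    + D1 * (P * trunc_pow m.+1 w * ph2 z * (al - (be + 1) * w + w ^+ 2 * z + D3 * (u - w))
          + trunc_pow m.+2 w * ph2' z * (be * w - w ^+ 2 * z + D4 * (v - z)))
    <= C - P / 8 * (D3 * (trunc_pow m.+2 u * ph1 v) + D1 * (trunc_pow m.+2 w * ph2 z)).
Proof.
move=> P0 al0 be0 M0 e0 e4 D1_0 D2_0 D3_0 D4_0 D1e D3e D2e D4e b1 b2 s1 s2.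
have [C1 H1] := @reaction_le R m.+1 P al be M eps U1 ph1 ph1' b1 s1 D2 P0 al0 be0 M0 e4 D2_0 D2e.
have [C2 H2] := @reaction_le R m.+1 P al be M eps U2 ph2 ph2' b2 s2 D4 P0 al0 be0 M0 e4 D4_0 D4e.
exists (`|D3 * C1 + D1 * C2|) => // u v w z u0 vM w0 zM.
have [f1 f2 _ _] := b1 _ vM; have [g1 g2 _ _] := b2 _ zM.
have R1 := H1 u v z u0 vM zM; have R2 := H2 w z v w0 zM vM.
have f12 : 1 <= ph1 v <= 1 + eps by rewrite f1.
have g12 : 1 <= ph2 z <= 1 + eps by rewrite g1.
have cpl := coupling_le m u w (ltW e0) f12 g12.
have Xu := trunc_pow_ge0 m.+2 u; have Xw := trunc_pow_ge0 m.+2 w.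
rewrite /reaction in R1 R2.
have nC := ler_norm (D3 * C1 + D1 * C2).
move: (trunc_pow m.+2 u) (trunc_pow m.+2 w) (trunc_pow m.+1 u) (trunc_pow m.+1 w) Xu Xw R1 R2 cpl
  => xu xw yu yw Xu Xw R1 R2 cpl.
have k1 := ler_wpM2l (ltW D3_0) R1; have k2 := ler_wpM2l (ltW D1_0) R2.
have DDP : 0 <= D1 * D3 * P by rewrite !mulr_ge0// ltW.
have k3 := ler_wpM2l DDP cpl.
have PD3 : 0 <= P * D3 * xu by rewrite !mulr_ge0// ltW.
have PD1 : 0 <= P * D1 * xw by rewrite !mulr_ge0// ltW.
have k4 := ler_wpM2r PD3 D1e; have k5 := ler_wpM2r PD1 D3e.
have f2' : ph1 v <= 2 by lra.
have g2' : ph2 z <= 2 by lra.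
have k6 := ler_wpM2l PD3 f2'; have k7 := ler_wpM2l PD1 g2'.
lra.
Qed.

(** The function [expR (de t) (E t - C / de)] has nonpositive derivative. *)
Lemma gronwall (E E' : R -> R) (s C de : R) (T : \bar R) : 0 < de ->
  (forall t : R, s <= t -> (t%:E < T)%E -> is_derive t 1 E (E' t)) ->
  (forall t, s <= t -> (t%:E < T)%E -> E' t <= C - de * E t) ->
  forall t, s <= t -> (t%:E < T)%E -> E t <= C / de + `|E s - C / de|.
Proof.
move=> de0 dE E'le t st tT.
pose G r := expR (de * r) * (E r - C / de).
pose G' r := expR (de * r) * (de * E r - C + E' r).
have below r : r <= t -> (r%:E < T)%E by move=> rt; apply: le_lt_trans tT; rewrite lee_fin.
have dG (r : R) : s <= r <= t -> is_derive r 1 G (G' r).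
  move=> /andP[sr rt]; have d1 := dE r sr (below _ rt).
  have d2 : is_derive r 1 (fun r : R => de * r) de.
    by apply: is_derive_eq; rewrite /GRing.scale/= mulr1.
  have d3 := is_derive_comp_dir d2 (is_derive_expR (de * r)).
  have d4 := is_deriveB d1 (is_derive_cst (C / de) r 1).
  apply: (is_derive_eq (is_deriveM d3 d4)).
  rewrite /G' /GRing.scale/= subr0 !fctE/=.
  by field; rewrite gt_eqF.
have Gle : G t <= G s.
  move: st; rewrite le_eqVlt => /predU1P[->//|st].
  have [||c] := @MVT _ G G' s t st.
  - by move=> r; rewrite in_itv/= => /andP[sr rt]; apply: dG; rewrite !ltW.
  - apply: derivable_within_continuous => r; rewrite in_itv/= => /dG ?; exact: ex_derive.
  rewrite in_itv/= => /andP[sc ct] GE; rewrite -subr_le0 GE.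
  rewrite pmulr_lle0 ?subr_gt0// /G' pmulr_rle0 ?expR_gt0//.
  have := E'le c (ltW sc) (below _ (ltW ct)); lra.
rewrite -lerBlDl; have et : 0 < expR (de * t) by exact: expR_gt0.
rewrite -(ler_pM2l et); apply: (le_trans Gle).
apply: (@le_trans _ _ (expR (de * s) * `|E s - C / de|)).
  by rewrite ler_pM2l ?expR_gt0// ler_norm.
by rewrite ler_wpM2r// ler_expR ler_pM2l.
Qed.

(** The integral of a nonnegative function is a supremum over the simple functions below it, and
    those below [f] extended by zero are below [g]. *)
Lemma ge0_subset_integral_le d (X : measurableType d) (mu : {measure set X -> \bar R})
    (D : set X) (f g : X -> \bar R) :
  (forall x, D x -> 0 <= f x)%E -> (forall x, 0 <= g x)%E ->
  (forall x, D x -> f x <= g x)%E ->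
  (\int[mu]_(x in D) f x <= \int[mu]_x g x)%E.
Proof.
move=> f0 g0 fg; rewrite ge0_integralE// ge0_integralTE//.
apply: ereal_sup_le => _ [h hf <-]; exists h => // x; apply: (le_trans (hf x)).
by rewrite patchE; case: ifPn => // /set_mem; exact: fg.
Qed.

Lemma integ_le_volume (N : nat) (r C : R) (f : 'rV[R]_N -> R) : 0 <= C ->
  continuous f -> vanishes_outside r f -> (forall x, f x <= C) ->
  integ f <= C * fine (lebesgue_tuple R N (tuple_box r)).
Proof.
move=> C0 cf fr fC; have mB := @tuple_box_measurable R N r.
have iB : (lebesgue_tuple R N).-integrable setT (EFin \o (\1_(tuple_box r) : _ -> R)).
  apply: (@bounded_support_integrable _ _ _ _ (tuple_box r) _ 1) => //.
  - exact: lebesgue_tuple_box_lty.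
  - by move=> y; rewrite indicE; case: (_ \in _); rewrite ?normr1// normr0.
  - by move=> y yr; rewrite indicE memNset.
have -> : fine (lebesgue_tuple R N (tuple_box r)) = \int[lebesgue_tuple R N]_y \1_(tuple_box r) y.
  by rewrite /Rintegral integral_indic// setIT.
rewrite -RintegralZl//; apply: le_Rintegral => //.
- exact: (compact_support_integrable cf fr).
- rewrite (_ : EFin \o _ = (fun y => C%:E * (EFin \o \1_(tuple_box r)) y)%E) //.
  exact: integrableZl.
- move=> y _; rewrite indicE; case: (boolP (y \in _)) => [_|/negP yr].
    by rewrite mulr1.
  rewrite mulr0 fr//; apply: notin_tuple_box => yr'; apply: yr; exact: mem_set.
Qed.

End coupling.

(** * Bounds on the polynomial, the diffusion form and the functional *)

Section bounds.
Context {R : realType}.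

Lemma H_poly_ge0 (th si rh : nat -> R) n (u v w z : R) :
  (forall k, [/\ 0 < th k, 0 < si k & 0 < rh k]) ->
  0 <= u -> 0 <= v -> 0 <= w -> 0 <= z -> 0 <= H_poly th si rh n u v w z.
Proof.
move=> pos u0 v0 w0 z0; apply: sumr_ge0 => p _; apply: sumr_ge0 => q _.
apply: sumr_ge0 => r _; have [t0 _ _] := pos r; have [_ s0 _] := pos q; have [_ _ r0] := pos p.
by do 7 (apply: mulr_ge0; last first; first by [exact: exprn_ge0|exact: ltW]); rewrite !mulr_ge0.
Qed.

(** The polynomial is homogeneous of degree [n] with positive coefficients. *)
Lemma H_poly_le (th si rh : nat -> R) n (S u v w z : R) :
  (forall k, [/\ 0 < th k, 0 < si k & 0 < rh k]) ->
  0 <= u <= S -> 0 <= v <= S -> 0 <= w <= S -> 0 <= z <= S ->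
  H_poly th si rh n u v w z <= H_poly th si rh n 1 1 1 1 * S ^+ n.
Proof.
move=> pos /andP[u0 uS] /andP[v0 vS] /andP[w0 wS] /andP[z0 zS].
have S0 : 0 <= S by exact: le_trans uS.
rewrite /H_poly mulr_suml; apply: ler_sum => p _; rewrite mulr_suml; apply: ler_sum => q _.
rewrite mulr_suml; apply: ler_sum => r _; rewrite !expr1n !mulr1.
have [t0 _ _] := pos r; have [_ s0 _] := pos q; have [_ _ r0] := pos p.
set c := _ * rh p; have c0 : 0 <= c.
  by do 3 (apply: mulr_ge0; last exact: ltW); rewrite !mulr_ge0// ler0n.
have pw x k : 0 <= x -> x <= S -> 0 <= x ^+ k <= S ^+ k.
  by move=> x0 xS; rewrite exprn_ge0//=; apply: lerXn2r; rewrite // nnegrE.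
have Sn : S ^+ n = S ^+ r * S ^+ (q - r) * S ^+ (p - q) * S ^+ (n - p).
  have rq : (r <= q)%N by rewrite -ltnS.
  have qp : (q <= p)%N by rewrite -ltnS.
  have pn : (p <= n)%N by rewrite -ltnS.
  by rewrite -!exprD !subnKC.
have /andP[a1 b1] := pw u r u0 uS; have /andP[a2 b2] := pw v (q - r)%N v0 vS.
have /andP[a3 b3] := pw w (p - q)%N w0 wS; have /andP[a4 b4] := pw z (n - p)%N z0 zS.
rewrite Sn -3!(mulrA c) ler_wpM2l//.
apply: ler_pM => //; first by rewrite !mulr_ge0.
apply: ler_pM => //; first by rewrite mulr_ge0.
exact: ler_pM.
Qed.

Lemma expr_sum3_le k (x y z : R) : 0 <= x -> 0 <= y -> 0 <= z ->
  (x + y + z) ^+ k <= 3 ^+ k * (x ^+ k + y ^+ k + z ^+ k).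
Proof.
move=> x0 y0 z0; have xk := exprn_ge0 k x0; have yk := exprn_ge0 k y0; have zk := exprn_ge0 k z0.
have main mx : 0 <= mx -> x + y + z <= 3 * mx -> mx ^+ k <= x ^+ k + y ^+ k + z ^+ k ->
    (x + y + z) ^+ k <= 3 ^+ k * (x ^+ k + y ^+ k + z ^+ k).
  move=> m0 h h'; apply: (@le_trans _ _ ((3 * mx) ^+ k)).
    by apply: lerXn2r; rewrite // nnegrE ?addr_ge0 ?mulr_ge0.
  by rewrite exprMn ler_wpM2l// exprn_ge0.
have [xy|yx] := leP x y; have [yz|zy] := leP y z; have [xz|zx] := leP x z;
  first [by apply: (main z) => //; lra|by apply: (main y) => //; lra|by apply: (main x) => //; lra].
Qed.

Lemma H_poly_le_trunc_pow (th si rh : nat -> R) n (M : R) : 0 <= M ->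
  (forall k, [/\ 0 < th k, 0 < si k & 0 < rh k]) ->
  exists2 K : R, 0 <= K & forall u v w z : R, 0 <= u -> 0 <= v <= M -> 0 <= w -> 0 <= z <= M ->
    H_poly th si rh n u v w z <= K + K * (trunc_pow n.+4 u + trunc_pow n.+4 w).
Proof.
move=> M0 pos; pose c := H_poly th si rh n 1 1 1 1.
have c0 : 0 <= c by apply: H_poly_ge0.
pose K := c * 3 ^+ n.+4 * (1 + (M + 1) ^+ n.+4).
have M1 : 0 <= (M + 1) ^+ n.+4 by rewrite exprn_ge0// addr_ge0.
have c3 : 0 <= c * 3 ^+ n.+4 by rewrite mulr_ge0// exprn_ge0.
have K0 : 0 <= K by rewrite /K mulr_ge0// addr_ge0.
exists K => // u v w z u0 /andP[v0 vM] w0 /andP[z0 zM].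
have Xu := trunc_pow_ge0 n.+4 u; have Xw := trunc_pow_ge0 n.+4 w.
have pu : 0 <= Num.max (u - 1) 0 by rewrite le_max lexx orbT.
have pw : 0 <= Num.max (w - 1) 0 by rewrite le_max lexx orbT.
have pu' : u - 1 <= Num.max (u - 1) 0 by rewrite le_max lexx.
have pw' : w - 1 <= Num.max (w - 1) 0 by rewrite le_max lexx.
have := expr_sum3_le n.+4 (addr_ge0 M0 ler01) pu pw.
rewrite -/(trunc_pow n.+4 u) -/(trunc_pow n.+4 w).
move: (Num.max (u - 1) 0) (Num.max (w - 1) 0) pu pw pu' pw' => x y x0 y0 ux wy.
(* [S] dominates all four variables and is at least 1, so raising the exponent from [n] to [n + 4]
   only increases its power. *)
set S := M + 1 + x + y => h.
have S1 : 1 <= S by rewrite /S; lra.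
apply: (@le_trans _ _ (c * S ^+ n)).
  by apply: H_poly_le => //; apply/andP; split => //; rewrite /S; lra.
apply: (@le_trans _ _ (c * S ^+ n.+4)).
  by rewrite ler_wpM2l// -[n.+4]addn4 exprD ler_peMr ?exprn_ege1// exprn_ge0//; lra.
apply: (le_trans (ler_wpM2l c0 h)); rewrite mulrA.
rewrite (_ : K + _ = c * 3 ^+ n.+4 * ((1 + (M + 1) ^+ n.+4) *
    (1 + (trunc_pow n.+4 u + trunc_pow n.+4 w)))); last by rewrite /K; ring.
rewrite ler_wpM2l//.
move: ((M + 1) ^+ n.+4) (trunc_pow n.+4 u) (trunc_pow n.+4 w) M1 Xu Xw => m p q m0 p0 q0.
have : 0 <= m * (p + q) by rewrite mulr_ge0// addr_ge0.
lra.
Qed.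

Lemma quadratic_form_ge0 (A B C p q : R) : 0 < A -> B ^+ 2 <= 4 * A * C ->
  0 <= A * p ^+ 2 + B * (p * q) + C * q ^+ 2.
Proof.
move=> A0 disc; rewrite -(pmulr_rge0 _ (mulr_gt0 (ltr0n R 4) A0)).
have -> : 4 * A * (A * p ^+ 2 + B * (p * q) + C * q ^+ 2) =
    (2 * A * p + B * q) ^+ 2 + (4 * A * C - B ^+ 2) * q ^+ 2 by ring.
by rewrite addr_ge0 ?sqr_ge0// mulr_ge0 ?sqr_ge0// subr_ge0.
Qed.

(** With [y] the positive part of [x - 1], the power [m + 2] of [y] factors out and leaves a form in
    [p] and [y q]. With [P = m + 4], its discriminant condition follows from
    [(a + b)^2 f'^2 <= 2 a b f''] and [P <= 2 (P - 1) f]. *)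
Lemma energy_form_ge0 (m : nat) (a b f f' f'' x p q : R) : 0 < a -> 0 < b ->
  1 <= f -> (a + b) ^+ 2 / (2 * a * b) * f' ^+ 2 <= f'' ->
  0 <= a * (m.+4%:R * (m.+3%:R * trunc_pow m.+2 x) * f) * p ^+ 2
     + (a + b) * (m.+4%:R * trunc_pow m.+3 x * f') * (p * q)
     + b * (trunc_pow m.+4 x * f'') * q ^+ 2.
Proof.
move=> a0 b0 f1 ff.
rewrite (trunc_pow_mul m.+3) (trunc_pow_mul m.+2); set y := Num.max (x - 1) 0.
have X0 := trunc_pow_ge0 m.+2 x; move: (trunc_pow m.+2 x) X0 => X X0.
rewrite (_ : _ + _ = X * (a * m.+4%:R * m.+3%:R * f * p ^+ 2 +
   (a + b) * m.+4%:R * f' * (p * (y * q)) + b * f'' * (y * q) ^+ 2)); last by ring.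
apply: mulr_ge0 => //; have P0 : 0 < m.+4%:R :> R by rewrite ltr0n.
have Q2 : m.+4%:R <= 2 * m.+3%:R :> R by rewrite -(natr1 m.+3) mulr_natl mulr2n lerD2l ler1n.
have ab0 : 0 < 2 * a * b by rewrite !mulr_gt0.
have ff' : (a + b) ^+ 2 * f' ^+ 2 <= 2 * a * b * f''.
  by rewrite -ler_pdivrMl// mulrA [X in X * _]mulrC.
move: (m.+4%:R : R) (m.+3%:R : R) P0 Q2 => P Q P0 Q2.
have Q0 : 0 < Q by lra.
apply: quadratic_form_ge0; first by rewrite !mulr_gt0//; lra.
have f''0 : 0 <= 2 * a * b * f'' by apply: le_trans ff'; rewrite mulr_ge0 ?sqr_ge0.
rewrite !exprMn; apply: (@le_trans _ _ (P ^+ 2 * (2 * a * b * f''))).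
  by rewrite mulrAC mulrC ler_wpM2l// sqr_ge0.
rewrite (_ : 4 * _ * _ = (P * (2 * Q * f)) * (2 * a * b * f'')); last by ring.
rewrite ler_wpM2r// expr2 ler_pM2l//.
have : 2 * Q * 1 <= 2 * Q * f by rewrite ler_pM2l// mulr_gt0.
lra.
Qed.

Variables (N : nat) (r : R).
Implicit Types f g h : 'rV[R]_N -> R.

Definition compactly_supported f := continuous f /\ vanishes_outside r f.

Lemma compactly_supported_lin (a b : R) f g :
  compactly_supported f -> compactly_supported g ->
  compactly_supported (fun x => a * f x + b * g x) /\
  integ (fun x => a * f x + b * g x) = a * integ f + b * integ g.
Proof.
move=> [cf fr] [cg gr].
have cZ (e : R) k : continuous k -> continuous (fun x : 'rV[R]_N => e * k x).
  by move=> ck x; exact (continuousM (@cst_continuous _ _ e x) (ck x)).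
have cfa := cZ a f cf; have cgb := cZ b g cg.
have vfa : vanishes_outside r (fun x => a * f x) by move=> x /fr ->; rewrite mulr0.
have vgb : vanishes_outside r (fun x => b * g x) by move=> x /gr ->; rewrite mulr0.
split.
  split; first by move=> x; exact (continuousD (cfa x) (cgb x)).
  by move=> x rx; rewrite fr// gr// !mulr0 addr0.
by rewrite (integD cfa vfa cgb vgb) (integZ _ cf fr) (integZ _ cg gr).
Qed.

Lemma integ_ge0 f : (forall x, 0 <= f x) -> 0 <= integ f.
Proof. by move=> f0; apply: Rintegral_ge0. Qed.

(** The constant [K] is carried by the indicator of a box containing [Om], which keeps the majorant
    integrable on the whole space. *)
Lemma integral_rV_le (Om : set 'rV[R]_N) (K : R) h f : 0 <= K ->
  (forall x, Om x -> `|x| <= r) -> (forall x, Om x -> 0 <= h x) ->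
  (forall x, Om x -> h x <= K + f x) -> (forall x, 0 <= f x) -> compactly_supported f ->
  (`|integral_rV Om (EFin \o h)| <=
    (K * fine (lebesgue_tuple R N (tuple_box r)) + integ f)%:E)%E.
Proof.
move=> K0 Or h0 hf f0 [cf fr]; have mB := @tuple_box_measurable R N r.
rewrite gee0_abs; last by apply: integral_ge0 => y Oy; rewrite lee_fin; exact: h0.
have iB : (lebesgue_tuple R N).-integrable setT (EFin \o (fun y => K * \1_(tuple_box r) y)).
  apply: (@bounded_support_integrable _ _ _ _ (tuple_box r) _ K) => //.
  - exact: lebesgue_tuple_box_lty.
  - by apply: measurable_funM => //; apply: measurable_indic.
  - move=> y; rewrite normrM (ger0_norm K0) indicE; case: (_ \in _).
      by rewrite normr1 mulr1.
    by rewrite normr0 mulr0.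
  - by move=> y yr; rewrite indicE memNset// mulr0.
have iF := compact_support_integrable cf fr.
apply: (@le_trans _ _ (\int[lebesgue_tuple R N]_y
    ((K * \1_(tuple_box r) y)%:E + (f (rV_of_tuple y))%:E))%E).
  apply: ge0_subset_integral_le.
  - by move=> y Oy; rewrite lee_fin; exact: h0.
  - by move=> y; rewrite -EFinD lee_fin addr_ge0// mulr_ge0.
  - move=> y Oy; rewrite -EFinD lee_fin indicE mem_set ?mulr1; first exact: hf.
    by move=> i; have := coord_le_norm (rV_of_tuple y) i; rewrite mxE => /le_trans; apply; exact: Or.
rewrite integralD// EFinD leeD//; last by rewrite fineK// integrable_fin_num.
have box_fin : lebesgue_tuple R N (tuple_box r) \is a fin_num.
  by rewrite ge0_fin_numE// lebesgue_tuple_box_lty.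
rewrite (_ : (fun y => (K * \1_(tuple_box r) y)%:E) = (fun y => K%:E * (\1_(tuple_box r) y)%:E)%E)//.
rewrite ge0_integralZl//; last exact/measurable_EFinP/measurable_indic.
by rewrite integral_indic// setIT EFinM fineK.
Qed.

End bounds.

(** * The energy inequality with truncated powers *)

Section truncated_energy.
Context {R : realType} {N : nat} (Om : set 'rV[R]_N) (T : \bar R).
Variables (m : nat) (u v : R -> 'rV[R]_N -> R) (ph ph' : R -> R).

Definition trunc_pow' (x : R) : R := m.+4%:R * trunc_pow m.+3 x.

Definition density := energy_density u v (trunc_pow m.+4) ph.

Definition source a b := energy_source u v a b (trunc_pow m.+4) trunc_pow' ph ph'.

(** The exponent [m + 4] leaves [m + 2] for the second derivative, which is then still
    differentiable, hence continuous, for every [m]. *)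
Lemma truncated_energy_rate u0 v0 (r a b M : R) (ph'' : R -> R) (t : R) :
  open Om -> (forall x, Om x -> `|x| <= r) ->
  classical_component Om T u0 u -> classical_component Om T v0 v ->
  0 < a -> 0 < b ->
  (forall x : R, 0 <= x ->
    [/\ is_derive x 1 ph (ph' x), is_derive x 1 ph' (ph'' x) & {for x, continuous ph''}]) ->
  (forall y, 0 <= y <= M -> 1 <= ph y /\ (a + b) ^+ 2 / (2 * a * b) * ph' y ^+ 2 <= ph'' y) ->
  0 < t -> (t%:E < T)%E -> (forall x, Om x -> v t x <= M) ->
  [/\ compactly_supported r (ext0 Om (density t)),
      compactly_supported r (ext0 Om (source a b t)) &
      exists2 E', is_derive t 1 (fun s => integ (ext0 Om (density s))) E' &
        E' <= integ (ext0 Om (source a b t))].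
Proof.
move=> oO Or Cu Cv a0 b0 dph phM t0 tT vM.
have d0 (x : R) : is_derive x 1 (trunc_pow m.+4) (trunc_pow' x) by exact: trunc_pow_is_derive.
pose xi2 x : R := m.+4%:R * (m.+3%:R * trunc_pow m.+2 x).
have d1 (x : R) : is_derive x 1 trunc_pow' (xi2 x).
  exact: (is_deriveZ (m.+4%:R) (trunc_pow_is_derive m.+1 x)).
have cxi2 : continuous xi2.
  move=> x; apply: cvgM; first exact: cvg_cst.
  apply: cvgM; first exact: cvg_cst.
  exact: (is_derive_continuous (trunc_pow_is_derive m x)).
have van x : x <= 1 -> [/\ trunc_pow m.+4 x = 0, trunc_pow' x = 0 & xi2 x = 0].
  by move=> x1; rewrite /trunc_pow' /xi2 !trunc_pow_eq0// !mulr0.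
have dp1 (x : R) : 0 <= x -> is_derive x 1 ph (ph' x) by move=> /dph[].
have dp2 (x : R) : 0 <= x -> is_derive x 1 ph' (ph'' x) by move=> /dph[].
have cp2 (x : R) : 0 <= x -> {for x, continuous ph''} by move=> /dph[].
split.
- split; last exact: ext0_vanishes_outside.
  exact (ext0_continuous_slice oO Cu ltr01 (energy_density_vanishes v ph van)
    (energy_density_continuous oO Cu Cv d0 dp1) t0 tT).
- split; last exact: ext0_vanishes_outside.
  exact (ext0_continuous_slice oO Cu ltr01 (energy_source_vanishes v a b ph ph' van)
    (energy_source_continuous oO Cu Cv d0 d1 dp1 dp2) t0 tT).
exists (integ (ext0 Om (energy_density_t u v (trunc_pow m.+4) trunc_pow' ph ph' t))).
  exact: (energy_is_derive oO Or Cu Cv ltr01 d0 d1 van dp1 dp2 t0 tT).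
apply: (energy_rate_le oO Or Cu Cv ltr01 d0 d1 cxi2 van dp1 dp2 cp2 t0 tT vM).
move=> x y p q /phM[f1 f2]; exact: energy_form_ge0.
Qed.

End truncated_energy.

(** * Assembly of the uniform bound *)

Lemma le_sub_of_eq (R : realDomainType) (I a1 a2 b1 b2 B k y : R) :
  I = 1 * (a1 + a2) + k * y -> b1 <= a1 -> b2 <= a2 -> I <= B -> b1 + b2 <= B - k * y.
Proof. by move=> ->; lra. Qed.

Lemma sum_le_of_weighted (R : realFieldType) (x y p q B : R) : 0 < p -> 0 < q ->
  0 <= x -> 0 <= y -> p * x + q * y <= B -> x + y <= B / p + B / q.
Proof.
move=> p0 q0 x0 y0 h; have px := mulr_ge0 (ltW p0) x0; have qy := mulr_ge0 (ltW q0) y0.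
by rewrite lerD// ler_pdivlMr// mulrC; lra.
Qed.

Theorem theorem3p2 (R : realType) (N : nat) (Om : set 'rV[R]_N)
    (a b c d alpha beta D1 D2 D3 D4 : R)
    (u0 v0 w0 z0 : 'rV[R]_N -> R)
    (u v w z : R -> 'rV[R]_N -> R) (Tmax : \bar R)
    (theta sigma rho : R) (n : nat) (theta_ sigma_ rho_ : nat -> R) :
  let A12 := diffusion_ratio a b in
  let A13 := diffusion_ratio a c in
  let A14 := diffusion_ratio a d in
  let A23 := diffusion_ratio b c in
  let A24 := diffusion_ratio b d in
  let A34 := diffusion_ratio c d in
  let Lambda := (theta ^+ 2 - A12 ^+ 2) * (sigma ^+ 2 - A23 ^+ 2)
                - (A13 - A12 * A23) ^+ 2 in
  let V := (theta ^+ 2 - A12 ^+ 2) * (sigma ^+ 2 * rho ^+ 2 - A24 ^+ 2)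
           - (A14 - A12 * A24) ^+ 2 in
  let Gamma := (theta ^+ 2 - A12 ^+ 2) * (A34 * sigma ^+ 2 - A23 * A24)
               - (A13 - A12 * A23) * (A14 - A12 * A24) in
  (0 < N)%N -> domain Om -> bounded_set Om -> C1_boundary Om ->
  0 < a -> 0 < b -> 0 < c -> 0 < d -> 0 < alpha -> 0 < beta ->
  0 < D1 -> 0 < D2 -> 0 < D3 -> 0 < D4 ->
  initial_datum Om u0 -> initial_datum Om v0 ->
  initial_datum Om w0 -> initial_datum Om z0 ->
  0 < theta -> 0 < sigma -> 0 < rho ->
  theta ^+ 2 > A12 ^+ 2 ->
  (theta ^+ 2 - A12 ^+ 2) * (sigma ^+ 2 - A23 ^+ 2) > (A13 - A12 * A23) ^+ 2 ->
  Lambda * V > Gamma ^+ 2 ->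
  (0 < n)%N ->
  (forall k, [/\ 0 < theta_ k, 0 < sigma_ k & 0 < rho_ k]) ->
  (forall r q p : nat, (r <= q <= p)%N -> (p <= n)%N ->
    [/\ theta_ r * theta_ r.+2 / theta_ r.+1 ^+ 2 = theta ^+ 2,
        sigma_ q * sigma_ q.+2 / sigma_ q.+1 ^+ 2 = sigma ^+ 2 &
        rho_ p * rho_ p.+2 / rho_ p.+1 ^+ 2 = rho ^+ 2]) ->
  (0%E < Tmax)%E ->
  brusselator_solution Om Tmax a b c d alpha beta D1 D2 D3 D4
    u0 v0 w0 z0 u v w z ->
  exists M : R, forall t : R, 0 <= t -> (t%:E < Tmax)%E ->
    (`|L_functional Om theta_ sigma_ rho_ n u v w z t| <= M%:E)%E.
Proof.
move=> _ _ _ _ _ _ _ _ _ N0 [oO _ _] bO _ a0 b0 c0 d0 al0 be0 D1_0 D2_0 D3_0 D4_0 _ _ _ _ _ _ _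
  _ _ _ _ pos _ T0 S.
have Cu := solution_u S; have Cv := solution_v S; have Cw := solution_w S; have Cz := solution_z S.
have [s s0 sT] := later_time T0.
have [r Or] : exists r, forall x, Om x -> `|x| <= r.
  have [r0 [_ Obd]] := bO; exists (`|r0| + 1) => x Ox; apply: Obd => //.
  by rewrite (le_lt_trans (ler_norm _))// ltrDl.
pose vol := fine (lebesgue_tuple R N (tuple_box r)).
have ge0 y0 y : classical_component Om Tmax y0 y -> forall t x, 0 <= t -> (t%:E < Tmax)%E -> Om x -> 0 <= y t x.
  by move=> Cy; exact: (component_ge0 Cy).
have Hge0 t x : 0 <= t -> (t%:E < Tmax)%E -> Om x ->
    0 <= H_poly theta_ sigma_ rho_ n (u t x) (v t x) (w t x) (z t x).
  by move=> t0 tT Ox; apply: H_poly_ge0 => //; [exact: (ge0 _ _ Cu)|exact: (ge0 _ _ Cv)|exact: (ge0 _ _ Cw)|exact: (ge0 _ _ Cz)].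
(* The energy is used from time [s] on: the data are merely bounded at time 0. *)
suff [M HM] : exists M : R, forall t : R, s <= t -> (t%:E < Tmax)%E ->
    (`|L_functional Om theta_ sigma_ rho_ n u v w z t| <= M%:E)%E.
  have [M' HM'] : exists M' : R, forall t : R, 0 <= t <= s ->
      (`|L_functional Om theta_ sigma_ rho_ n u v w z t| <= M'%:E)%E.
    have [B1 HB1] := component_bounded Cu sT; have [B2 HB2] := component_bounded Cv sT.
    have [B3 HB3] := component_bounded Cw sT; have [B4 HB4] := component_bounded Cz sT.
    pose B := `|B1| + `|B2| + `|B3| + `|B4|.
    have B0 : 0 <= B by rewrite !addr_ge0.
    pose K := H_poly theta_ sigma_ rho_ n 1 1 1 1 * B ^+ n.
    have K0 : 0 <= K by rewrite mulr_ge0 ?exprn_ge0// H_poly_ge0.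
    exists (K * vol + integ (cst 0 : 'rV[R]_N -> R)) => t /[dup] ts /andP[t0 t_le_s].
    have tT : (t%:E < Tmax)%E by apply: le_lt_trans sT; rewrite lee_fin.
    apply: integral_rV_le => //; first by move=> x; exact: Hge0.
      move=> x Ox; rewrite addr0.
      have n1 := normr_ge0 B1; have n2 := normr_ge0 B2; have n3 := normr_ge0 B3; have n4 := normr_ge0 B4.
      have l1 := ler_norm B1; have l2 := ler_norm B2; have l3 := ler_norm B3; have l4 := ler_norm B4.
      have i1 := le_trans (ler_norm _) (HB1 t x ts Ox); have i2 := le_trans (ler_norm _) (HB2 t x ts Ox).
      have i3 := le_trans (ler_norm _) (HB3 t x ts Ox); have i4 := le_trans (ler_norm _) (HB4 t x ts Ox).
      have g1 := ge0 _ _ Cu t x t0 tT Ox; have g2 := ge0 _ _ Cv t x t0 tT Ox.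
      have g3 := ge0 _ _ Cw t x t0 tT Ox; have g4 := ge0 _ _ Cz t x t0 tT Ox.
      by apply: H_poly_le => //; apply/andP; split => //; rewrite /B; lra.
    by split => //; exact: cst_continuous.
  exists (Num.max M M') => t t0 tT; have [st|ts] := leP s t.
    by apply: (le_trans (HM _ st tT)); rewrite lee_fin le_max lexx.
  apply: (le_trans (HM' t _)); first by rewrite t0 ltW.
  by rewrite lee_fin le_max lexx orbT.
have source_le (x y : R) : 1 <= y -> beta * x - x ^+ 2 * y <= beta ^+ 2 / 4.
  move=> y1; have h : x ^+ 2 * 1 <= x ^+ 2 * y by rewrite ler_wpM2l// sqr_ge0.
  by have := sqr_ge0 (x - beta / 2); rewrite sqrrB; lra.
have [M0 HM0] : exists M : R, forall t x, s <= t -> (t%:E < Tmax)%E -> Om x -> v t x <= M /\ z t x <= M.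
  apply: (@cooperative_bounded R N Om Tmax v z v0 z0 b d D2 D4 (beta ^+ 2 / 4) s (Ordinal N0)) => //.
  - by move=> t x t0 tT Ox v1; rewrite (equation_v S)//; have := source_le (u t x) _ v1; lra.
  - by move=> t x t0 tT Ox z1; rewrite (equation_z S)//; have := source_le (w t x) _ z1; lra.
pose M := Num.max M0 1.
have M_gt0 : 0 < M by rewrite lt_max ltr01 orbT.
have HM t x : s <= t -> (t%:E < Tmax)%E -> Om x -> (0 <= v t x <= M) /\ (0 <= z t x <= M).
  move=> st tT Ox; have t0 : 0 <= t by rewrite (le_trans (ltW s0)).
  have [vM zM] := HM0 t x st tT Ox.
  by rewrite (ge0 _ _ Cv)// (ge0 _ _ Cz)// !le_max vM zM.
pose P : R := n.+4%:R.
have P1 : 1 <= P by rewrite ler1n.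
have P0 : 0 < P by exact: lt_le_trans P1.
(* As [P >= 1], the last two conditions follow from the bound 1/8, so one sum of the coupling
   constants fixes [e]. *)
have [e [e0 e4 [e1 e3 e2 e4']]] : exists e : R, [/\ 0 < e, e <= 1 / 4 & [/\ D1 * e <= 1 / 8,
    D3 * e <= 1 / 8, D2 * M * e <= P / 8 & D4 * M * e <= P / 8]].
  have q2 : 0 < D2 * M by exact: mulr_gt0.
  have q4 : 0 < D4 * M by exact: mulr_gt0.
  pose q := 4 + 8 * (D1 + D3 + D2 * M + D4 * M); have q0 : 0 < q by rewrite /q; lra.
  have le_e x y : 0 <= y -> x <= y * q -> x * q^-1 <= y by move=> y0 xy; rewrite ler_pdivrMr.
  exists q^-1; split; first by rewrite invr_gt0.
    by rewrite -[q^-1]mul1r; apply: le_e; rewrite /q; lra.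
  split; try by apply: le_e; rewrite /q; lra.
  - by apply: (@le_trans _ _ (1 / 8)); [apply: le_e; rewrite /q; lra|lra].
  - by apply: (@le_trans _ _ (1 / 8)); [apply: le_e; rewrite /q; lra|lra].
have kap_gt0 x y : 0 < x -> 0 < y -> 0 < (x + y) ^+ 2 / (2 * x * y) :> R.
  by move=> x0 y0; rewrite divr_gt0 ?exprn_gt0 ?addr_gt0// !mulr_gt0.
have [U1 [f1 [f1' [f1'' [df1 bf1 sf1]]]]] := weight_exists (kap_gt0 _ _ a0 b0) M_gt0 be0 P0 e0 e4.
have [U2 [f2 [f2' [f2'' [df2 bf2 sf2]]]]] := weight_exists (kap_gt0 _ _ c0 d0) M_gt0 be0 P0 e0 e4.
have [C C0 HC] : exists2 C : R, 0 <= C & forall x y x' y' : R, 0 <= x -> 0 <= y <= M -> 0 <= x' -> 0 <= y' <= M ->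
    D3 * (P * trunc_pow n.+3 x * f1 y * (alpha - (beta + 1) * x + x ^+ 2 * y + D1 * (x' - x))
          + trunc_pow n.+4 x * f1' y * (beta * x - x ^+ 2 * y + D2 * (y' - y)))
    + D1 * (P * trunc_pow n.+3 x' * f2 y' * (alpha - (beta + 1) * x' + x' ^+ 2 * y' + D3 * (x - x'))
          + trunc_pow n.+4 x' * f2' y' * (beta * x' - x' ^+ 2 * y' + D4 * (y - y')))
    <= C - P / 8 * (D3 * (trunc_pow n.+4 x * f1 y) + D1 * (trunc_pow n.+4 x' * f2 y')).
  (* The index [n + 2] makes the two exponents [P - 1] and [P]. *)
  apply: (@dissipation R n.+2 P alpha beta M e U1 U2 D1 D2 D3 D4 f1 f1' f2 f2') => //.
    by move=> y /bf1[].
  by move=> y /bf2[].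
pose G1 t := ext0 Om (density n u v f1 t); pose G2 t := ext0 Om (density n w z f2 t).
pose F1 t := ext0 Om (source n u v f1 f1' a b t); pose F2 t := ext0 Om (source n w z f2 f2' c d t).
have rate1 t : s <= t -> (t%:E < Tmax)%E -> [/\ compactly_supported r (G1 t), compactly_supported r (F1 t) &
    exists2 E', is_derive t 1 (fun t => integ (G1 t)) E' & E' <= integ (F1 t)].
  move=> st tT; apply: (@truncated_energy_rate R N Om Tmax n u v f1 f1' u0 v0 r a b M f1'' t) => //.
  - by move=> y /bf1[].
  - exact: lt_le_trans st.
  - by move=> x Ox; have [/andP[]] := HM t x st tT Ox.
have rate2 t : s <= t -> (t%:E < Tmax)%E -> [/\ compactly_supported r (G2 t), compactly_supported r (F2 t) &
    exists2 E', is_derive t 1 (fun t => integ (G2 t)) E' & E' <= integ (F2 t)].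
  move=> st tT; apply: (@truncated_energy_rate R N Om Tmax n w z f2 f2' w0 z0 r c d M f2'' t) => //.
  - by move=> y /bf2[].
  - exact: lt_le_trans st.
  - by move=> x Ox; have [_ /andP[]] := HM t x st tT Ox.
pose E t := D3 * integ (G1 t) + D1 * integ (G2 t).
have dE t : s <= t -> (t%:E < Tmax)%E -> exists2 E', is_derive t 1 E E' & E' <= C * vol - P / 8 * E t.
  move=> st tT; have [cG1 cF1 [E1 dE1 E1le]] := rate1 t st tT.
  have [cG2 cF2 [E2 dE2 E2le]] := rate2 t st tT.
  exists (D3 * E1 + D1 * E2).
    by apply: (is_derive_eq (is_deriveD (is_deriveZ D3 dE1) (is_deriveZ D1 dE2))).
  have [cF iF] := compactly_supported_lin D3 D1 cF1 cF2.
  have [cG iG] := compactly_supported_lin D3 D1 cG1 cG2.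
  (* Source plus [P / 8] times density is at most [C] pointwise and supported in the box, so its
     integral is at most [C * vol]. *)
  have [[cFG vFG] iFG] := compactly_supported_lin 1 (P / 8) cF cG.
  have h1 : D3 * E1 <= D3 * integ (F1 t) := ler_wpM2l (ltW D3_0) E1le.
  have h2 : D1 * E2 <= D1 * integ (F2 t) := ler_wpM2l (ltW D1_0) E2le.
  have iE := etrans iFG (congr2 (fun p q => 1 * p + P / 8 * q) iF iG).
  apply: (le_sub_of_eq iE h1 h2).
  apply: integ_le_volume => // x.
  pose val (p q g h : R) : R := 1 * (D3 * p + D1 * q) + P / 8 * (D3 * g + D1 * h).
  suff : val (F1 t x) (F2 t x) (G1 t x) (G2 t x) <= C by [].
  have [Ox|Ox] := pselect (Om x); last first.
    have vE p q g h : p = 0 -> q = 0 -> g = 0 -> h = 0 -> val p q g h <= C.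
      by move=> -> -> -> ->; rewrite /val !mulr0 addr0 !mulr0 addr0.
    exact: (vE _ _ _ _ (ext0N _ Ox) (ext0N _ Ox) (ext0N _ Ox) (ext0N _ Ox)).
  have t_gt0 : 0 < t by exact: lt_le_trans st.
  have [vM zM] := HM t x st tT Ox.
  suff vE p q g h : p = source n u v f1 f1' a b t x -> q = source n w z f2 f2' c d t x ->
      g = density n u v f1 t x -> h = density n w z f2 t x -> val p q g h <= C.
    exact: (vE _ _ _ _ (ext0E _ Ox) (ext0E _ Ox) (ext0E _ Ox) (ext0E _ Ox)).
  move=> -> -> -> ->; rewrite /val mul1r -lerBrDr.
  rewrite /source /energy_source /density /energy_density /trunc_pow'.
  rewrite (equation_u S)// (equation_v S)// (equation_w S)// (equation_z S)//.
  exact: (HC _ _ _ _ (ge0 _ _ Cu t x (ltW t_gt0) tT Ox) vM (ge0 _ _ Cw t x (ltW t_gt0) tT Ox) zM).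
(* The derivatives found time by time are gathered into one function, as [gronwall] expects. *)
have {dE} [E' dE] : exists E' : R -> R, forall t, s <= t -> (t%:E < Tmax)%E ->
    is_derive t 1 E (E' t) /\ E' t <= C * vol - P / 8 * E t.
  exists (fun t => 'D_1 E t) => t st tT; have [E1 dE1 E1le] := dE t st tT.
  by rewrite (@derive_val _ _ _ _ _ _ _ dE1).
have P8 : 0 < P / 8 by rewrite divr_gt0.
have Ele t : s <= t -> (t%:E < Tmax)%E -> E t <= C * vol / (P / 8) + `|E s - C * vol / (P / 8)|.
  by apply: (gronwall P8 (E' := E')) => t' st' tT'; have [] := dE t' st' tT'.
have [K K0 HK] := H_poly_le_trunc_pow n (ltW M_gt0) pos.
set B := _ + `|_| in Ele.
exists (K * vol + K * (B / D3 + B / D1)) => t st tT.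
have t_gt0 : 0 < t by exact: lt_le_trans st.
have [cG1 _ _] := rate1 t st tT; have [cG2 _ _] := rate2 t st tT.
have dens_ge x : Om x -> trunc_pow n.+4 (u t x) <= G1 t x /\ trunc_pow n.+4 (w t x) <= G2 t x.
  move=> Ox; have [/bf1[g1 _ _ _ _] /bf2[g2 _ _ _ _]] := HM t x st tT Ox.
  by rewrite /G1 /G2 !ext0E// /density /energy_density !ler_peMr ?trunc_pow_ge0.
have G_ge0 x : 0 <= G1 t x /\ 0 <= G2 t x.
  have [Ox|Ox] := pselect (Om x); last by rewrite /G1 /G2 !ext0N.
  by have [g1 g2] := dens_ge x Ox; split; [apply: le_trans g1|apply: le_trans g2]; exact: trunc_pow_ge0.
have i1 : 0 <= integ (G1 t) by apply: integ_ge0 => x; have [] := G_ge0 x.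
have i2 : 0 <= integ (G2 t) by apply: integ_ge0 => x; have [] := G_ge0 x.
have [cG iG] := compactly_supported_lin K K cG1 cG2.
apply: (@le_trans _ _ (K * vol + integ (fun x => K * G1 t x + K * G2 t x))%:E).
  apply: integral_rV_le => //.
  - by move=> x Ox; apply: Hge0 => //; exact: ltW.
  - move=> x Ox; have [vM zM] := HM t x st tT Ox.
    apply: (le_trans (HK _ _ _ _ (ge0 _ _ Cu t x (ltW t_gt0) tT Ox) vM (ge0 _ _ Cw t x (ltW t_gt0) tT Ox) zM)).
    have [g1 g2] := dens_ge x Ox.
    by rewrite lerD2l -mulrDr ler_wpM2l// lerD.
  - by move=> x; have [g1 g2] := G_ge0 x; rewrite addr_ge0// mulr_ge0.
rewrite lee_fin iG lerD2l -mulrDr ler_wpM2l//.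
exact: (sum_le_of_weighted D3_0 D1_0 i1 i2 (Ele t st tT)).
Qed.
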